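(* (a) For the wrapped Cauchy distributions $\mathrm{WC}_1(\eta,\rho)$, $\eta\in\mathbb{S}_1$, $0\le\rho<1$, we have $\beta(\rho)=2\rho/(1-\rho)$ and, for all $\eta\in\mathbb{S}_1$ and $0\le\rho\le 1/3$, $$\mathrm{WC}_1(\eta,\rho)=(1-\beta(\rho))\,\mathrm{unif}(\mathbb{S}_1)+\beta(\rho)\sum_{n=1}^\infty \mathrm{geo}_{\mathbb{N}}(n|1-\rho)\,\Delta^0_{n,\eta}.$$ (b) For the wrapped normal distributions $\mathrm{WN}_1(\eta,\rho)$, $\eta\in\mathbb{S}_1$, $\rho>0$, we have $\beta(\rho)=2\sum_{n=1}^\infty e^{-n^2\rho/2}$. The equation $\beta(\rho)=1$ has a unique solution $\rho_0\approx 1.570818$, and with $$\mathrm{br}(n|\rho):=2\beta(\rho)^{-1}e^{-n^2\rho/2},\quad n\in\mathbb{N},$$ it holds for all $\eta\in\mathbb{S}_1$ and $\rho\ge\rho_0$ that $$\mathrm{WN}_1(\eta,\rho)=(1-\beta(\rho))\,\mathrm{unif}(\mathbb{S}_1)+\beta(\rho)\sum_{n=1}^\infty \mathrm{br}(n|\rho)\,\Delta^0_{n,\eta}.$$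
   Context: $\mathbb{S}_1=\{x\in\mathbb{R}^2:\|x\|=1\}$ with uniform distribution $\mathrm{unif}(\mathbb{S}_1)$; densities on $\mathbb{S}_1$ are with respect to it. $\eta^{t}x$ is the Euclidean inner product, $\mathbb{N}=\{1,2,\dots\}$, and $T_n$ is the Chebyshev polynomial of the first kind of degree $n$. Wrapping: for a distribution $\mu$ on $\mathbb{R}$ the wrapped distribution is the push-forward of $\mu$ under $x\mapsto(\cos x,\sin x)^{t}\in\mathbb{S}_1$. $\mathrm{WN}_1(\eta,\rho)$ is the wrapped version of the normal distribution $N(\alpha,\sigma^2)$ with $\eta=(\cos\alpha,\sin\alpha)^{t}$ and $\rho=\sigma^2>0$. $\mathrm{WC}_1(\eta,\rho)$, $\rho\in(0,1)$, is the wrapped version of the distribution of $\sigma X+\alpha$, where $X$ is standard Cauchy with Lebesgue density $x\mapsto 1/(\pi(1+x^2))$, $\eta=(\cos\alpha,\sin\alpha)^{t}$, $\sigma>0$ and $\rho=e^{-\sigma}$; $\mathrm{WC}_1(\eta,0)=\mathrm{unif}(\mathbb{S}_1)$. Definition of $\beta(\rho)$: if a family of distributions on $\mathbb{S}_1$ has densities $x\mapsto g_\rho(\eta^{t}x)$ and $\nu_1$ denotes the push-forward of $\mathrm{unif}(\mathbb{S}_1)$ under $x\mapsto\eta^{t}x$ (independent of $\eta$), then with $\langle f,g\rangle_0=\int fg\,d\nu_1$ and $\|f\|_0^2=\langle f,f\rangle_0$ one puts $\beta_n(\rho)=\langle g_\rho,T_n\rangle_0\,\|T_n\|_0^{-2}$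 for $n\in\mathbb{N}$ and $\beta(\rho)=\sum_{n=1}^\infty|\beta_n(\rho)|$. $\Delta^0_{n,\eta}$, $n\in\mathbb{N}$, is the probability distribution on $\mathbb{S}_1$ with density $x\mapsto 1+T_n(\eta^{t}x)$. $\mathrm{geo}_{\mathbb{N}}(\cdot|p)$ is the zero-truncated counterpart of the geometric distribution on $\{0,1,2,\dots\}$ with mass function $p(1-p)^n$, i.e. $\mathrm{geo}_{\mathbb{N}}(n|p)=p(1-p)^{n-1}$, $n\in\mathbb{N}$ (for $\rho=0$ the factor $\beta(\rho)$ in (a) is $0$ and the second term vanishes). *)

(* Defs.v *)
From HB Require Import structures.
From mathcomp Require Import all_boot all_order all_algebra.
From mathcomp Require Import all_classical all_reals all_analysis.
From mathcomp Require Import measurable_realfun lra.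

Set Implicit Arguments.
Unset Strict Implicit.
Unset Printing Implicit Defensive.
Import Order.TTheory GRing.Theory Num.Theory.
Import numFieldNormedType.Exports.

Local Open Scope classical_set_scope.
Local Open Scope ring_scope.

(* The plane is R * R with its product sigma-algebra.  A distribution on the
   unit circle S1 is represented by its image on the plane, so two of them are
   equal when they agree on every measurable set of R * R. *)

Section circle.
Context {R : realType}.
Implicit Types (eta x : R * R) (alpha t : R).

Definition dot eta x : R := eta.1 * x.1 + eta.2 * x.2.

(* The norm `|x| of the library on R * R is the sup norm; the Euclidean norm
   is Num.sqrt (dot x x). *)
Definition S1 : set (R * R) := [set x | Num.sqrt (dot x x) = 1].

(* measurableTypeR R is R with the sigma-algebra that carries the library's
   Lebesgue measure, normal and uniform laws. *)
Definition to_circle (t : measurableTypeR R) : R * R := (cos t, sin t).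

Lemma S1P eta : S1 eta <-> exists alpha, eta = to_circle alpha.
Proof.
split=> [|[a ->]]; last first.
  by rewrite /S1 /= /dot /= -!expr2 cos2Dsin2 sqrtr1.
case: eta => a b; rewrite /S1 /= /dot /= -!expr2.
move=> /(congr1 (fun u => u ^+ 2)).
rewrite sqr_sqrtr ?addr_ge0 ?sqr_ge0// expr1n => e1.
have b2 := sqr_ge0 b.
have a1 : -1 <= a <= 1 by apply/andP; split; nra.
have sE : Num.sqrt (1 - a ^+ 2) = `|b|.
  by rewrite -sqrtr_sqr; congr Num.sqrt; lra.
have [b0|b0] := leP 0 b.
  exists (acos a); rewrite /to_circle acosK ?in_itv//= sin_acos// sE.
  by rewrite ger0_norm.
exists (- acos a); rewrite /to_circle cosN sinN acosK ?in_itv//= sin_acos// sE.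
by rewrite ltr0_norm// opprK.
Qed.

Lemma measurable_dot eta : measurable_fun setT (dot eta).
Proof.
by apply: measurable_funD; apply: measurable_funM.
Qed.

HB.instance Definition _ eta :=
  isMeasurableFun.Build _ _ _ _ (dot eta) (measurable_dot eta).

Lemma measurable_to_circle : measurable_fun setT to_circle.
Proof.
apply: measurable_fun_pair; apply: continuous_measurable_fun.
  exact: continuous_cos.
exact: continuous_sin.
Qed.

HB.instance Definition _ :=
  isMeasurableFun.Build _ _ _ _ to_circle measurable_to_circle.

Lemma lt0_2pi : 0 < 2 * pi :> R.
Proof. by rewrite mulr_gt0// pi_gt0. Qed.

Definition unifS1 : probability (R * R)%type R :=
  distribution (uniform_prob lt0_2pi) to_circle.

Definition wrapped_law (mu : set (measurableTypeR R) -> \bar R) : set (R * R) -> \bar R :=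
  pushforward mu to_circle.

(* The library's normal_prob takes the standard deviation. *)
Definition WN alpha (rho : R) : set (R * R) -> \bar R :=
  wrapped_law (normal_prob alpha (Num.sqrt rho)).

Definition cauchy_std : set (measurableTypeR R) -> \bar R := fun A =>
  (\int[lebesgue_measure]_(x in A) (pi * (1 + x ^+ 2))^-1%:E)%E.

(* sigma = - ln rho is the solution of rho = expR (- sigma). *)
Definition WC alpha (rho : R) : set (R * R) -> \bar R :=
  if rho == 0 then (unifS1 : set (R * R) -> \bar R) else
  wrapped_law (pushforward cauchy_std 
    (fun x : measurableTypeR R => - ln rho * x + alpha : measurableTypeR R)).

(* A family of distributions on S1 with parameter eta in S1 is represented by
   P : R -> set (R * R) -> \bar R, where P alpha is the member with parameter
   eta = to_circle alpha, for any of the angles alpha of eta.  A density profile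
   on [-1, 1] is extended to R as a nonnegative measurable function; the
   extension plays no role, since dot eta x lies in [-1, 1] on S1. *)
Definition has_profile (P : R -> set (R * R) -> \bar R) (g : R -> R) : Prop :=
  [/\ measurable_fun setT g, forall t, 0 <= g t &
    forall eta alpha (A : set (R * R)),
      S1 eta -> eta = to_circle alpha -> measurable A ->
      P alpha A = (\int[unifS1]_(x in A) (g (dot eta x))%:E)%E].

(* unifS1 is rotation invariant, so (1, 0) could be any other point of S1. *)
Definition nu1 : probability R R := distribution unifS1 (dot (1, 0)).

Definition inner0 (f g : R -> R) : R := \int[nu1]_t (f t * g t).

Fixpoint chebT (n : nat) : {poly R} :=
  match n with
  | 0 => 1
  | 1 => 'X
  | (m.+1 as k).+1 => 2%:P * 'X * chebT k - chebT m
  end.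

Definition beta_coef (g : R -> R) (n : nat) : R :=
  inner0 g (horner (chebT n)) / inner0 (horner (chebT n)) (horner (chebT n)).

Definition beta (g : R -> R) : \bar R :=
  (\sum_(1 <= n <oo) `|beta_coef g n|%:E)%E.

Definition Delta0 (n : nat) eta : set (R * R) -> \bar R := fun A =>
  (\int[unifS1]_(x in A) (1 + (chebT n).[dot eta x])%:E)%E.

(* Mass at n of the geometric distribution conditioned on being positive. *)
Definition geoN (n : nat) (p : R) : R := p * (1 - p) ^+ n.-1.

Definition br (n : nat) (rho b : R) : R :=
  2 * b^-1 * expR (- (n%:R ^+ 2 * rho / 2)).

Definition mixture (b : \bar R) (w : nat -> R) eta : set (R * R) -> \bar R :=
  fun A => ((1 - b) * unifS1 A
            + b * \sum_(1 <= n <oo) ((w n)%:E * Delta0 n eta A))%E.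

End circle.

(* Main.v *)
(** For a density f on the line, sum_k f(x + 2 pi k) is computed by passing to
    the limit in a finite Poisson summation: averaging a trigonometric series
    over the M translates by 2 pi / M keeps exactly the frequencies divisible
    by M.  Averaging Poisson kernels of parameter exp(-s/M), rescaled by M,
    gives the Cauchy density in the limit; averaging cos^(2N), with
    N ~ 2 M^2 / rho, gives the normal density, while the ratios
    C(2N, N + jM) / C(2N, N) tend to exp(-j^2 rho / 2).  Both limits are
    dominated.  In the normal case the multiplicative constant is recovered
    from the total mass.

    Hence both wrapped laws have a density 1 + 2 sum_n c_n T_n(eta^t x) with
    c_n >= 0 and b := 2 sum_n c_n finite.  Since
    1 - b + sum_n 2 c_n (1 + T_n) is this density, and 1 + T_n >= 0, the
    mixture representation and the coefficients beta_n = 2 c_n follow by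
    interchanging sums and integrals of nonnegative functions only. *)

Require Import Defs.
From HB Require Import structures.
From mathcomp Require Import all_boot all_order all_algebra.
From mathcomp Require Import all_classical all_reals all_analysis.
From mathcomp Require Import measurable_realfun lra ring.
Import Order.TTheory GRing.Theory Num.Theory.
Import numFieldNormedType.Exports.
Local Open Scope classical_set_scope.
Local Open Scope ring_scope.

Set Implicit Arguments.
Unset Strict Implicit.
Unset Printing Implicit Defensive.

(** * Finite Poisson summation *)

(** The obstacle is to identify the densities of the wrapped laws without Fourier inversion. Poisson
    kernels and powers of [(1 + cos y) / 2] have explicit cosine expansions, so averaging them over
    translates is an exact identity, and all the analysis lies in elementary bounds for [cos] and
    [expR]. The number of translates is odd, M = 2m + 1, so that they are centred at x; those with
    index k <= m stay within one period of the rescaled kernel, where the bounds hold. The average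
    of Poisson kernels does not depend on m. That of cosine powers does, and carries a factor free
    of x whose limit is known only to be positive. A density determines its profile only almost
    everywhere for [nu1], whereas beta has to be found for every profile of the family. An explicit
    [profile] is therefore built, and any other one is compared with it through integrals over
    measurable sets. The root rho0 is caught between the ends of an interval of length 10^-6, where
    beta is compared with 1 by rational bounds for the exponential. *)

Section tannery.
Context {R : realType}.

Lemma cvg_sum_nat (u : nat -> nat -> R) (l : nat -> R) K :
  (forall k, u m k @[m --> \oo] --> l k) ->
  \sum_(0 <= k < K) u m k @[m --> \oo] --> \sum_(0 <= k < K) l k.
Proof.
move=> ul; elim: K => [|K IH].
  by rewrite big_geq//; under eq_fun do rewrite big_geq//; exact: cvg_cst.
by rewrite big_nat_recr//=; under eq_fun do rewrite big_nat_recr//=; exact: cvgD.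
Qed.

(** Dominated convergence for sums of growing length: past some K all tails are below e / 3, and the
    first K terms converge. The bound is asked for [k < N m] only, because a rescaled periodic
    kernel decays only within its period. *)
Lemma tannery (u : nat -> nat -> R) (l v : nat -> R) (N : nat -> nat) :
  (forall k, u m k @[m --> \oo] --> l k) ->
  (\forall m \near \oo, forall k, (k < N m)%N -> `|u m k| <= v k) ->
  cvgn (series v) -> (forall m, (m <= N m)%N) ->
  cvgn (series l) /\
  \sum_(k < N m) u m k @[m --> \oo] --> limn (series l).
Proof.
move=> ul uv cv mN.
have N_ge k : \forall m \near \oo, (k < N m)%N.
  by near=> m; apply: leq_trans (mN m); near: m; exists k.+1.
have lv k : `|l k| <= v k.
  have h : `|u m k| @[m --> \oo] --> `|l k| by exact: cvg_norm.
  rewrite -(cvg_lim (@Rhausdorff R) h); apply: limr_le; first exact: cvgP h.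
  near=> m.
  have uvm : forall j, (j < N m)%N -> `|u m j| <= v j by near: m.
  by apply: uvm; near: m; exact: N_ge.
have v_ge0 k : 0 <= v k by rewrite (le_trans _ (lv k)).
have cl : cvgn (series l).
  apply: (@normed_cvg R R^o).
  apply: (@series_le_cvg _ (fun k => `|l k|) v) => //.
split=> //.
have tail e : 0 < e -> exists K, forall n, (K <= n)%N ->
    \sum_(K <= k < n) v k <= e.
  move=> e0.
  have /cvgrPdist_lt/(_ _ (divr_gt0 e0 (ltr0Sn _ 1)))[K _ hK] := cv.
  exists K => n Kn.
  have -> : \sum_(K <= k < n) v k = series v n - series v K.
    by rewrite /series /= (big_cat_nat (leq0n K) Kn)//= addrAC subrr add0r.
  have := hK K (leqnn _); have := hK n Kn; rewrite /= !ltr_norml.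
  by move=> /andP[? ?] /andP[? ?]; lra.
apply/cvgrPdist_le => /= e e0.
have e30 : 0 < e / 3 by rewrite divr_gt0.
have [K hK] := tail _ e30.
have tailN (w : nat -> R) n : (K <= n)%N -> (forall k, (k < n)%N -> `|w k| <= v k) ->
    `|\sum_(K <= k < n) w k| <= e / 3.
  move=> Kn wv; rewrite (le_trans _ (hK _ Kn))// (le_trans (ler_norm_sum _ _ _))//.
  rewrite big_nat_cond [leRHS]big_nat_cond ler_sum// => k /andP[/andP[_ kn] _].
  exact: wv.
have head : \sum_(0 <= k < K) u m k @[m --> \oo] --> \sum_(0 <= k < K) l k.
  exact: cvg_sum_nat.
have limtail : `|limn (series l) - \sum_(0 <= k < K) l k| <= e / 3.
  have h : `|series l n - \sum_(0 <= k < K) l k| @[n --> \oo] -->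
      `|limn (series l) - \sum_(0 <= k < K) l k|.
    by apply: cvg_norm; apply: cvgB => //; exact: cvg_cst.
  rewrite -(cvg_lim (@Rhausdorff R) h); apply: limr_le; first exact: cvgP h.
  near=> n.
  have Kn : (K <= n)%N by near: n; exists K.
  rewrite /series /= (big_cat_nat (leq0n K) Kn)//= addrAC subrr add0r.
  exact: tailN.
near=> m.
have KN : (K <= N m)%N by apply: ltnW; near: m; exact: N_ge.
have uvm : forall k, (k < N m)%N -> `|u m k| <= v k by near: m.
have hm : `|\sum_(0 <= k < K) l k - \sum_(0 <= k < K) u m k| <= e / 3.
  near: m; exact: (cvgrPdist_le _ _).1 head _ e30.
rewrite -(big_mkord xpredT (u m)) (big_cat_nat (leq0n K) KN)//=.
have := tailN _ _ KN uvm; move: limtail hm.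
rewrite !ler_norml => /andP[? ?] /andP[? ?] /andP[? ?].
by apply/andP; split; lra.
Unshelve. all: by end_near. Qed.

End tannery.

Section finite_poisson.
Context {R : realType}.
Implicit Types (f : R -> R) (a : nat -> R) (x y : R).

(** A sum over all integers, folded onto [nat] by pairing k with -k so that ordinary series apply;
    [cos_term] folds an even Fourier series in the same way. *)
Definition wrap_term f x (k : nat) : R :=
  if k is 0 then f x else f (x + 2 * pi * k%:R) + f (x - 2 * pi * k%:R).

Definition cos_term a x (n : nat) : R :=
  (if n is 0 then 1 else 2) * a n * cos (n%:R * x).

(** The Dirichlet kernel, multiplied through by [sin (y / 2)] so that zeros of this sine are covered
    as well. *)
Lemma dirichlet y L :
  sin (y / 2) * \sum_(0 <= k < L.+1) cos_term (fun=> 1) y k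
  = sin ((L%:R + 2^-1) * y).
Proof.
elim: L => [|L IH].
  by rewrite big_nat1 /cos_term mul0r cos0 !mulr1 add0r mulrC.
rewrite big_nat_recr//= mulrDr IH /cos_term mulr1.
have -> : (L%:R + 2^-1) * y = L.+1%:R * y - y / 2 by rewrite -natr1; field.
have -> : (L.+1%:R + 2^-1) * y = L.+1%:R * y + y / 2 by field.
by rewrite sinB sinD; ring.
Qed.

Lemma cos_periodn x n : cos (x + 2 * pi * n%:R) = cos x.
Proof.
rewrite (_ : 2 * pi * n%:R = pi *+ 2 *+ n); last by rewrite -[RHS]mulr_natr -[pi *+ 2]mulr_natr; ring.
exact: (periodicn (@cosD2pi R)).
Qed.

Lemma sin_pi_frac_neq0 n M : (0 < M)%N -> ~~ (M %| n)%N ->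
  sin (2 * pi * n%:R / M%:R / 2) != 0 :> R.
Proof.
move=> M0 Mn; have M0' : M%:R != 0 :> R by rewrite pnatr_eq0 -lt0n.
rewrite [in n%:R](divn_eq n M) natrD natrM.
rewrite (_ : _ / 2 = pi * (n %% M)%:R / M%:R + pi *+ (n %/ M)); last first.
  by rewrite -mulr_natr; field.
rewrite (alternatingn (@sinDpi R)) mulf_neq0 ?signr_eq0//.
rewrite gt_eqF// sin_gt0_pi// !mulr_gt0 ?pi_gt0 ?ltr0n ?invr_gt0//=.
- rewrite -mulrA gtr_pMr ?pi_gt0// ltr_pdivrMr ?ltr0n// mul1r ltr_nat.
  by rewrite ltn_pmod.
- by rewrite lt0n; move: Mn; rewrite /dvdn.
- by rewrite ltr0n.
Qed.

(** Orthogonality of roots of unity in real form. Pairing k with -k cancels the sine parts and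
    leaves [cos (n x / M)], with M = 2L + 1, times the Dirichlet kernel at [2 pi n / M]. *)
Lemma sum_wrap_cos n L x :
  \sum_(0 <= k < L.+1) wrap_term (fun t => cos (n%:R * (t / L.*2.+1%:R))) x k =
  if (L.*2.+1 %| n)%N then L.*2.+1%:R * cos (n%:R * (x / L.*2.+1%:R)) else 0.
Proof.
set M := L.*2.+1; have M0 : M%:R != 0 :> R by rewrite pnatr_eq0.
set y : R := 2 * pi * n%:R / M%:R.
transitivity (cos (n%:R * (x / M%:R)) *
    \sum_(0 <= k < L.+1) cos_term (fun=> 1) y k).
  rewrite big_distrr/=; apply: eq_bigr => -[_|k _].
    by rewrite /cos_term /= mul0r cos0 !mulr1.
  rewrite /wrap_term /cos_term.
  have -> : n%:R * ((x + 2 * pi * k.+1%:R) / M%:R) =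
    n%:R * (x / M%:R) + k.+1%:R * y by rewrite /y; field.
  have -> : n%:R * ((x - 2 * pi * k.+1%:R) / M%:R) =
    n%:R * (x / M%:R) - k.+1%:R * y by rewrite /y; field.
  by rewrite cosB cosD; ring.
case: ifPn => Mn.
  rewrite mulrC; congr (_ * _).
  have yE : y = 2 * pi * (n %/ M)%:R.
    by rewrite /y -{1}(divnK Mn) natrM; field.
  transitivity (\sum_(0 <= k < L.+1) ((if k is 0 then 1 else 2) : R)).
    apply: eq_bigr => k _; rewrite /cos_term mulr1 yE.
    rewrite (_ : k%:R * (2 * pi * (n %/ M)%:R) = 0 + 2 * pi * (k * (n %/ M))%N%:R).
      by rewrite cos_periodn cos0 mulr1.
    by rewrite natrM; ring.
  rewrite /M; elim: L {M y yE M0 Mn} => [|L IH]; first by rewrite big_nat1.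
  by rewrite big_nat_recr//= IH doubleS -!natr1; ring.
(* Here [(L + 1/2) y = pi n], so the right-hand side of the Dirichlet identity vanishes, while
   [sin (y / 2)] does not since M does not divide n. *)
have := dirichlet y L.
have ME : M%:R = 2 * L%:R + 1 :> R by rewrite /M -natr1 -muln2 natrM mulrC.
rewrite (_ : (L%:R + _) * y = pi *+ n); last first.
  by rewrite -[RHS]mulr_natr /y ME; field; rewrite -ME.
rewrite -[pi *+ n]add0r (alternatingn (@sinDpi R)) sin0 mulr0.
move=> /eqP; rewrite mulf_eq0 (negPf (sin_pi_frac_neq0 _ Mn))// => /eqP ->.
by rewrite mulr0.
Qed.

Lemma sum_nat_dvd (g : nat -> R) M X : (0 < M)%N ->
  \sum_(0 <= n < X * M) (if (M %| n)%N then g n else 0) =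
  \sum_(0 <= j < X) g (j * M)%N.
Proof.
move=> M0; elim: X => [|X IH]; first by rewrite mul0n !big_geq.
rewrite big_nat_recr//= -IH mulSn addnC (big_cat_nat (n := X * M))//=; last first.
  exact: leq_addr.
congr (_ + _); rewrite big_ltn ?dvdn_mull//; last first.
  by rewrite -[ltnLHS]addn0 ltn_add2l.
rewrite big_nat_cond big1 ?addr0// => i /andP[/andP[i1 i2] _].
case: ifPn => // /dvdnP[q qE]; exfalso.
move: i1 i2; rewrite qE ltn_pmul2r// -mulSnr ltn_pmul2r// ltnS.
by case: ltngtP.
Qed.

(** A surviving frequency j M in the variable t / M is the frequency j in x, so averaging samples
    the coefficients with step M. A length that is a multiple of M leaves exactly X samples. *)
Lemma sum_wrap_trig a X L x :
  \sum_(0 <= k < L.+1) wrap_term (fun t =>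
     \sum_(0 <= n < X * L.*2.+1) cos_term a (t / L.*2.+1%:R) n) x k =
  L.*2.+1%:R * \sum_(0 <= j < X) cos_term (fun j => a (j * L.*2.+1)%N) x j.
Proof.
set M := L.*2.+1; have M0 : M%:R != 0 :> R by rewrite pnatr_eq0.
transitivity (\sum_(0 <= n < X * M) (if (M %| n)%N then
    M%:R * cos_term a (x / M%:R) n else 0)); last first.
  rewrite sum_nat_dvd// big_distrr/=; apply: eq_bigr => j _.
  congr (_ * _); rewrite /cos_term natrM.
  have -> : j%:R * M%:R * (x / M%:R) = j%:R * x by field.
  by case: j.
transitivity (\sum_(0 <= k < L.+1) \sum_(0 <= n < X * M)
    (if n is 0 then 1 else 2) * a n * wrap_term (fun t => cos (n%:R * (t / M%:R))) x k).
  apply: eq_bigr => -[|k] _ /=; first exact: eq_bigr.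
  by rewrite -big_split/=; apply: eq_bigr => n _; rewrite [RHS]mulrDr.
rewrite exchange_big/=; apply: eq_bigr => n _.
rewrite -big_distrr/= sum_wrap_cos -/M; case: ifP => _; last by rewrite mulr0.
exact: mulrCA.
Qed.

End finite_poisson.

(** * Wrapping the Cauchy density *)

Section trigo_bounds.
Context {R : realType}.
Implicit Types x y : R.

Lemma is_derive_ge0_le (f df : R -> R) a b :
  (forall x, is_derive x 1 f (df x)) ->
  (forall x, a < x < b -> 0 <= df x) -> a <= b -> f a <= f b.
Proof.
move=> fdf df0 ab; apply: (@ger0_derive1_ndecr R f a b) => //.
- move=> x; rewrite in_itv/= => xab; rewrite derive1E.
  by have -> := @derive_val _ _ _ _ _ _ _ (fdf x); exact: df0.
- apply: continuous_subspaceT => x.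
  apply/differentiable_continuous/derivable1_diffP.
  by have := fdf x.
Qed.

Lemma sin_le_id x : 0 <= x -> sin x <= x.
Proof.
move=> x0; rewrite -subr_ge0.
have := @is_derive_ge0_le (fun x => x - sin x) (fun z => 1 - cos z) 0 x _ _ x0.
rewrite sin0 subr0; apply => z.
by move=> _; rewrite subr_ge0 cos_le1.
Qed.

Lemma cos_ge_quad x : 1 - x ^+ 2 / 2 <= cos x.
Proof.
wlog x0 : x / 0 <= x => [hw|].
  case: (leP 0 x) => [/hw //|x0].
  by rewrite -cosN -sqrrN hw// oppr_ge0 ltW.
rewrite -subr_ge0.
have := @is_derive_ge0_le (fun x => cos x - (1 - x ^+ 2 / 2))
  (fun z => z - sin z) 0 x _ _ x0.
rewrite cos0 expr0n mul0r subr0 subrr; apply => z.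
  apply: is_derive_eq; rewrite /GRing.scale/=.
  by field.
by move=> /andP[z0 _]; rewrite subr_ge0 sin_le_id// ltW.
Qed.

Lemma sin_ge_mulcos x : 0 <= x <= pi -> x * cos x <= sin x.
Proof.
move=> /andP[x0 xpi]; rewrite -subr_ge0.
have := @is_derive_ge0_le (fun x => sin x - x * cos x)
  (fun z => z * sin z) 0 x _ _ x0.
rewrite sin0 mul0r subr0; apply => z.
  apply: is_derive_eq; rewrite /GRing.scale/=.
  by ring.
move=> /andP[z0 zx]; rewrite mulr_ge0 ?(ltW z0)//.
by rewrite sin_ge0_pi// (ltW z0) (le_trans _ xpi) ?(ltW zx).
Qed.

(** The derivative of [1 - cos x * expR (x ^+ 2 / 2)] is a positive multiple of [sin x - x * cos x],
    which is nonnegative on [0, pi]. *)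
Lemma cos_le_expR x : `|x| <= pi / 2 -> cos x <= expR (- (x ^+ 2 / 2)).
Proof.
wlog x0 : x / 0 <= x => [hw|].
  case: (leP 0 x) => [/hw //|x0].
  by rewrite -cosN -sqrrN -normrN; apply: hw; rewrite oppr_ge0 ltW.
rewrite ger0_norm// => xpi; rewrite expRN -div1r ler_pdivlMr ?expR_gt0//.
rewrite -subr_ge0.
have := @is_derive_ge0_le (fun x => 1 - cos x * expR (x ^+ 2 / 2))
  (fun z => (sin z - z * cos z) * expR (z ^+ 2 / 2)) 0 x _ _ x0.
rewrite cos0 expr0n mul0r expR0 mulr1 subrr; apply => z.
  apply: is_derive_eq; rewrite /GRing.scale/=.
  by field.
move=> /andP[z0 zx]; rewrite mulr_ge0 ?expR_ge0// subr_ge0.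
rewrite sin_ge_mulcos// (ltW z0)/= (le_trans (ltW zx))//.
by rewrite (le_trans xpi)// ler_pdivrMr// ler_peMr ?pi_ge0// ler1n.
Qed.

(** From [cos x ^+ 2 <= expR (- x ^+ 2) <= (1 + x ^+ 2)^-1] the squared sine is at least
    [x ^+ 2 / (1 + x ^+ 2)]; the constant 5 is 1 + 4, as |x| <= pi / 2 <= 2. *)
Lemma sin_sqr_ge x : `|x| <= pi / 2 -> x ^+ 2 / 5 <= sin x ^+ 2.
Proof.
move=> xpi; have x2 : `|x| <= 2 by rewrite (le_trans xpi)// ltW// pihalf_lt2.
have x4 : x ^+ 2 <= 4 by rewrite -real_normK ?num_real// (_ : 4 = 2 ^+ 2); [rewrite lerXn2r ?nnegrE|ring].
have c0 : 0 <= cos x by rewrite cos_ge0_pihalf -?ler_norml.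
have ce : cos x ^+ 2 <= expR (- x ^+ 2).
  rewrite (_ : - x ^+ 2 = 2%:R * - (x ^+ 2 / 2)); last by field.
  by rewrite expRM_natl lerXn2r ?nnegrE ?expR_ge0// cos_le_expR.
have : cos x ^+ 2 <= (1 + x ^+ 2)^-1.
  rewrite (le_trans ce)// expRN lef_pV2 ?posrE ?expR_gt0 ?expR_ge1Dx//.
  by rewrite ltr_wpDr// sqr_ge0.
rewrite sin2cos2; have : x ^+ 2 / 5 <= 1 - (1 + x ^+ 2)^-1.
  have : 0 <= x ^+ 2 by exact: sqr_ge0.
  move: (x ^+ 2) x4 => t t4 t0.
  rewrite (_ : 1 - _ = t / (1 + t)); last by field; rewrite gt_eqF// ltr_wpDr.
  by rewrite ler_wpM2l// lef_pV2 ?posrE; lra.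
lra.
Qed.

(** The previous bound at x / 2, through [cos x = 1 - 2 sin (x / 2) ^+ 2]. It reaches up to |x| =
    pi, as the whole window of rescaled translates requires. *)
Lemma cos_le_quad x : `|x| <= pi -> cos x <= 1 - x ^+ 2 / 10.
Proof.
move=> xpi; have := @sin_sqr_ge (x / 2).
rewrite normrM [`|2^-1|]gtr0_norm ?invr_gt0// ler_pM2r ?invr_gt0// => /(_ xpi).
have -> : cos x = cos ((x / 2) *+ 2) by congr cos; rewrite -mulr_natr; field.
rewrite cos_mulr2n sin2cos2 exprMn; lra.
Qed.

End trigo_bounds.

(** * The Poisson kernel: averages over translates and the rescaled limit *)

Section cauchy.
Context {R : realType}.
Implicit Types (r s x y : R) (m k n : nat).

(** The denominator is [1 - 2 r cos x + r ^+ 2], split into two nonnegative terms that are rescaled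
    and estimated separately. *)
Definition poisson_kernel r x : R :=
  (1 - r ^+ 2) / ((1 - r) ^+ 2 + 2 * r * (1 - cos x)).

Lemma poisson_den_gt0 r x : 0 <= r < 1 -> 0 < (1 - r) ^+ 2 + 2 * r * (1 - cos x).
Proof.
move=> /andP[r0 r1]; rewrite ltr_pwDl// ?exprn_gt0 ?subr_gt0//.
by rewrite !mulr_ge0// subr_ge0 cos_le1.
Qed.

(** After multiplication by the denominator the cosine series telescopes, by the product formula for
    [cos x * cos (n x)], up to a boundary term that vanishes with [r ^+ n.+1]. *)
Lemma poisson_kernel_partial r x n :
  ((1 - r) ^+ 2 + 2 * r * (1 - cos x)) *
    series (cos_term (fun n => r ^+ n) x) n.+1 =
  (1 - r ^+ 2) + r ^+ n.+1 * (2 * r * cos (n%:R * x) - 2 * cos (n.+1%:R * x)).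
Proof.
elim: n => [|n IH].
  rewrite /series/= big_nat1 /cos_term mul0r cos0 mul1r mul1r !mulr1 mul1r.
  by ring.
rewrite seriesSr mulrDr IH /cos_term.
have -> : n%:R * x = n.+1%:R * x - x by ring.
have -> : n.+2%:R * x = n.+1%:R * x + x by ring.
by rewrite cosB cosD !exprS; ring.
Qed.

Lemma cvg_poisson_kernel r x : 0 <= r < 1 ->
  series (cos_term (fun n => r ^+ n) x) n @[n --> \oo] --> poisson_kernel r x.
Proof.
move=> r01; have D0 := poisson_den_gt0 x r01; have /andP[r0 r1] := r01.
rewrite -cvg_shiftS.
pose err n := r ^+ n.+1 * (2 * r * cos (n%:R * x) - 2 * cos (n.+1%:R * x)).
rewrite (_ : (fun n => _) = fun n =>
    ((1 - r ^+ 2) + err n) / ((1 - r) ^+ 2 + 2 * r * (1 - cos x))); last first.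
  apply/funext => n /=; rewrite -poisson_kernel_partial mulrC mulKf//.
  by rewrite gt_eqF.
apply: cvgM; last exact: cvg_cst.
  rewrite -[X in _ --> X]addr0; apply: cvgD; first exact: cvg_cst.
apply/norm_cvg0P; apply: (@squeeze_cvgr _ _ _ _ (fun=> 0) (fun n => geometric 4 r n)).
- near=> n; rewrite normr_ge0/= /err normrM normrX ger0_norm// mulrC.
  rewrite ler_pM ?exprn_ge0//; last by rewrite exprS ler_piMl ?exprn_ge0// ltW.
  have rc : `|r * cos (n%:R * x)| <= 1.
    by rewrite normrM (ger0_norm r0) mulr_ile1// ?cos_max// ltW.
  have c := cos_max (n.+1%:R * x); move: rc c; rewrite -mulrA !ler_norml.
  by move=> /andP[? ?] /andP[? ?]; apply/andP; split; lra.
- exact: cvg_cst.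
- by apply: cvg_geometric; rewrite ger0_norm.
Unshelve. all: by end_near. Qed.

(** With [r = expR (- (s / M))] the sampled coefficients [r ^+ (j * M)] are [expR (- s) ^+ j]. The
    identity holds for partial sums of length [X * M] on the left and X on the right; then X tends
    to infinity. *)
Lemma sum_wrap_poisson s m x : 0 < s ->
  \sum_(0 <= k < m.+1) wrap_term (fun y => m.*2.+1%:R^-1 *
      poisson_kernel (expR (- (s / m.*2.+1%:R))) (y / m.*2.+1%:R)) x k =
  poisson_kernel (expR (- s)) x.
Proof.
move=> s0; set M := m.*2.+1; have M0 : 0 < M%:R :> R by rewrite ltr0n.
set r := expR _.
have r01 : 0 <= r < 1.
  by rewrite expR_ge0/= expR_lt1 oppr_lt0 divr_gt0.
have e01 : 0 <= expR (- s) < 1 by rewrite expR_ge0/= expR_lt1 oppr_lt0.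
have h X := sum_wrap_trig (fun n => r ^+ n) X m x.
apply: (@cvg_unique _ (@Rhausdorff R) (series (cos_term (fun j => expR (- s) ^+ j) x) n @[n --> \oo])); last exact: cvg_poisson_kernel.
have -> : series (cos_term (fun j => expR (- s) ^+ j) x) = fun X =>
   \sum_(0 <= k < m.+1) M%:R^-1 * wrap_term (fun t =>
     series (cos_term (fun n => r ^+ n) (t / M%:R)) (X * M)) x k.
  apply/funext => X; rewrite -big_distrr/= h mulrA mulVf ?gt_eqF// mul1r.
  apply: eq_bigr => j _; congr (_ * _ * _).
  rewrite -!expRM_natl natrM; congr expR.
  by rewrite -/M -mulrA [M%:R * _]mulrN mulrCA divff ?gt_eqF// mulr1.
have cvg_sub y : series (cos_term (fun n => r ^+ n) y) (X * M)%N @[X --> \oo] -->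
    poisson_kernel r y.
  apply: (cvg_comp (fun X => X * M)%N _ _ (@cvg_poisson_kernel r y r01)).
  exact: cvg_mulnr.
apply: cvg_sum_nat => -[|k]; rewrite /wrap_term.
  by apply: cvgM; [exact: cvg_cst|exact: cvg_sub].
by rewrite -mulrDr; apply: cvgM; [exact: cvg_cst|apply: cvgD; exact: cvg_sub].
Qed.

Lemma cvg_inv_odd : m.*2.+1%:R^-1 @[m --> \oo] --> (0 : R).
Proof.
apply: (@squeeze_cvgr _ _ _ _ (fun=> 0) (@harmonic R)).
- near=> m; rewrite invr_ge0 ler0n/= lef_pV2 ?posrE ?ltr0n// ler_nat ltnS.
  by rewrite -addnn leq_addr.
- exact: cvg_cst.
- exact: cvg_harmonic.
Unshelve. all: by end_near. Qed.

Lemma cvg_series_telescope (C : R) :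
  cvgn (series (fun k => C * (k.+1%:R^-1 * k.+2%:R^-1))).
Proof.
apply: (@cvgP _ _ (C * (1 - 0))).
rewrite (_ : series _ = fun n => C * (1 - n.+1%:R^-1)).
  by apply: cvgM; [exact: cvg_cst|apply: cvgB; [exact: cvg_cst|exact: cvg_harmonic]].
apply/funext; elim=> [|n IH]; first by rewrite /series/= big_geq// invr1 subrr mulr0.
by rewrite seriesSr IH; field; rewrite !gt_eqF ?ltr_wpDr.
Qed.

(** The lower bound gives summable domination; the upper one keeps y / M within [-pi, pi] as long as
    k <= m. The boolean is the sign of the translate. *)
Lemma cauchy_norm_ge x k : `|x| <= pi -> (0 < k)%N -> forall e : bool,
  2 * k%:R <= `|x + (-1) ^+ e * (2 * pi * k%:R)| <= pi * k.*2.+1%:R.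
Proof.
move=> xpi k0 e; have k1 : 1 <= k%:R :> R by rewrite ler1n.
have pi2 := @pi_ge2 R.
have -> : pi * k.*2.+1%:R = pi + 2 * pi * k%:R :> R.
  by rewrite -natr1 -muln2 natrM; ring.
have yE : `|(-1) ^+ e * (2 * pi * k%:R)| = 2 * pi * k%:R :> R.
  by rewrite normrMsign ger0_norm// !mulr_ge0// pi_ge0.
apply/andP; split; last first.
  by rewrite (le_trans (ler_normD _ _))// yE lerD2r.
have := ler_normB (x + (-1) ^+ e * (2 * pi * k%:R)) x.
rewrite addrAC subrr add0r yE => h; nra.
Qed.

(** Both bounds come from [1 + u <= expR u], at u = s t and at u = - s t. *)
Lemma expR_oneB_bounds s (t : R) : 0 < s -> 0 < t ->
  s / (1 + s * t) <= t^-1 * (1 - expR (- (s * t))) <= s.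
Proof.
move=> s0 t0; have st0 : 0 < s * t by rewrite mulr_gt0.
rewrite ![t^-1 * _]mulrC ler_pdivlMr// ler_pdivrMr//; apply/andP; split.
  rewrite mulrAC expRN.
  have h : (expR (s * t))^-1 <= (1 + s * t)^-1.
    by rewrite lef_pV2 ?posrE ?expR_gt0 ?expR_ge1Dx// ltr_wpDr// ltW.
  apply: (@le_trans _ _ (1 - (1 + s * t)^-1)); last by rewrite lerD2l lerN2.
  by rewrite le_eqVlt; apply/orP; left; apply/eqP; field; rewrite gt_eqF// ltr_wpDr// ltW.
by have := expR_ge1Dx (- (s * t)); lra.
Qed.

(** Put t = 1 / M and divide numerator and denominator by t^2. The quotient becomes
    [(1 + r) a / (a^2 + 2 r b)], where a = (1 - r) / t tends to s, b = (1 - cos (y t)) / t^2 tends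
    to y^2 / 2, and r tends to 1. *)
Lemma cvg_poisson_kernel_zoom s y : 0 < s ->
  m.*2.+1%:R^-1 * poisson_kernel (expR (- (s / m.*2.+1%:R))) (y / m.*2.+1%:R)
    @[m --> \oo] --> 2 * s / (s ^+ 2 + y ^+ 2).
Proof.
move=> s0; pose t m : R := m.*2.+1%:R^-1; pose r m := expR (- (s * t m)).
have t0 m : 0 < t m by rewrite invr_gt0 ltr0n.
have ct : t m @[m --> \oo] --> (0 : R) := cvg_inv_odd.
pose a m := (t m)^-1 * (1 - r m); pose b m := (t m) ^- 2 * (1 - cos (y * t m)).
have ca : a m @[m --> \oo] --> s.
  apply: (@squeeze_cvgr _ _ _ _ (fun m => s / (1 + s * t m)) (fun=> s)).
  - by near=> m; exact: expR_oneB_bounds.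
  - have e : s / (1 + s * 0) = s by rewrite mulr0 addr0 divr1.
    rewrite -[X in _ --> X]e.
    apply: cvgM; first exact: cvg_cst.
    apply: cvgV; first by rewrite mulr0 addr0 oner_neq0.
    by apply: cvgD; [exact: cvg_cst|apply: cvgM; [exact: cvg_cst|]].
  - exact: cvg_cst.
have cr : r m @[m --> \oo] --> (1 : R).
  rewrite (_ : r = fun m => 1 - t m * a m); last first.
    by apply/funext => m; rewrite /a mulVKf ?gt_eqF// opprB addrC subrK.
  have e : 1 - 0 * s = 1 by rewrite mul0r subr0.
  rewrite -[X in _ --> X]e.
  by apply: cvgB; [exact: cvg_cst|exact: cvgM].
have cb : b m @[m --> \oo] --> y ^+ 2 / 2.
  apply: (@squeeze_cvgr _ _ _ _
    (fun m => y ^+ 2 / 2 / (1 + (y * t m) ^+ 2 / 2)) (fun=> y ^+ 2 / 2)).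
  - near=> m.
    have ytm : `|y * t m| <= pi / 2.
      rewrite normrM (gtr0_norm (t0 m)) mulrC.
      near: m.
      have h : t m * `|y| @[m --> \oo] --> (0 : R).
        by rewrite -[X in _ --> X](mul0r `|y|); apply: cvgM => //; exact: cvg_cst.
      apply: (cvgr_le _ h); rewrite divr_gt0 ?pi_gt0//.
    have hu := cos_ge_quad (y * t m).
    have hl := cos_le_expR ytm.
    rewrite /b; set q := (y * t m) ^+ 2 / 2 in hu hl *.
    have q0 : 0 <= q by rewrite divr_ge0 ?sqr_ge0.
    have yq : y ^+ 2 / 2 = (t m) ^- 2 * q by rewrite /q; field; rewrite gt_eqF.
    have h3 : expR (- q) <= (1 + q)^-1.
      by rewrite expRN lef_pV2 ?posrE ?expR_gt0 ?expR_ge1Dx// ltr_wpDr.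
    rewrite yq -mulrA. rewrite !ler_pM2l ?invr_gt0 ?exprn_gt0//; apply/andP; split; last lra.
    have -> : q / (1 + q) = 1 - (1 + q)^-1 by field; rewrite gt_eqF// ltr_wpDr.
    lra.
  - have e0 : (y * 0) ^+ 2 / 2 = 0 :> R by rewrite mulr0 expr0n mul0r.
    have e : y ^+ 2 / 2 / (1 + (y * 0) ^+ 2 / 2) = y ^+ 2 / 2.
      by rewrite e0 addr0 divr1.
    rewrite -[X in _ --> X]e.
    apply: cvgM; first exact: cvg_cst.
    apply: cvgV; first by rewrite e0 addr0 oner_neq0.
    apply: cvgD; [exact: cvg_cst|apply: cvgM; [|exact: cvg_cst]].
    have h : y * t m @[m --> \oo] --> y * 0 by apply: cvgM; [exact: cvg_cst|].
    exact: cvgM.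
  - exact: cvg_cst.
rewrite (_ : (fun m => _) = fun m =>
    ((1 + r m) * a m) / (a m * a m + 2 * r m * b m)); last first.
  apply/funext => m; rewrite /poisson_kernel -/(t m) -/(r m) /a /b.
  have tm := t0 m; have r01 : 0 <= r m < 1.
    by rewrite expR_ge0/= expR_lt1 oppr_lt0 mulr_gt0.
  have := poisson_den_gt0 (y * t m) r01.
  move: (r m) (cos (y * t m)) r01 => rm c r01 D0.
  by field; rewrite (gt_eqF tm)/= -expr2 gt_eqF.
have e : 2 * s / (s ^+ 2 + y ^+ 2) = ((1 + 1) * s) / (s * s + 2 * 1 * (y ^+ 2 / 2)).
  by field; rewrite gt_eqF// ltr_pwDl ?mulr_gt0 ?sqr_ge0.
rewrite [X in _ --> X]e.
apply: cvgM; first by apply: cvgM => //; apply: cvgD => //; exact: cvg_cst.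
apply: cvgV; first by rewrite gt_eqF// mulr1 [2 * (_ / _)]mulrC divfK// ltr_pwDl ?mulr_gt0 ?sqr_ge0.
apply: cvgD; first exact: cvgM.
by apply: cvgM => //; apply: cvgM => //; exact: cvg_cst.
Unshelve. all: by end_near. Qed.

End cauchy.

(** * Domination of the rescaled Poisson kernels and the limit *)

Section cauchy_wrap.
Context {R : realType}.
Implicit Types (r s x y : R) (m k n : nat).

(** In [u (a^2 + 2 r b) = (1 + r) a], dropping the term with b bounds u near the centre, since a >=
    s / (1 + s). Dropping a^2 and using b >= y^2 / 10 gives the decay in y. *)
Lemma poisson_kernel_zoom_le s y m : 0 < s -> `|y| <= pi * m.*2.+1%:R ->
  let u := m.*2.+1%:R^-1 *
    poisson_kernel (expR (- (s / m.*2.+1%:R))) (y / m.*2.+1%:R) in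
  [/\ 0 <= u, u <= 2 * (1 + s) / s & u * y ^+ 2 <= 10 * s * expR s].
Proof.
move=> s0 yM; set t : R := m.*2.+1%:R^-1; rewrite -/t.
have t0 : 0 < t by rewrite invr_gt0 ltr0n.
have t1 : t <= 1 by rewrite invf_le1 ?ltr0n// ler1n.
have yt : `|y * t| <= pi by rewrite normrM (gtr0_norm t0) ler_pdivrMr ?ltr0n.
clearbody t.
have := expR_oneB_bounds s0 t0.
set r := expR _; set a := t^-1 * (1 - r) => /andP[a1 a2].
(* As t <= 1, r is at least [expR (- s)]; this is the source of the factor [expR s] in the last
   bound. *)
have re : r * expR s >= 1.
  by rewrite /r -expRD -expR0 ler_expR addrC subr_ge0 ler_piMr// ltW.
have r01 : 0 <= r < 1 by rewrite expR_ge0/= expR_lt1 oppr_lt0 mulr_gt0.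
have /andP[r0 r1] := r01.
have a0 : 0 < a by rewrite mulr_gt0 ?invr_gt0// subr_gt0.
have := cos_le_quad yt; set cs := cos _ => c.
have D0 := poisson_den_gt0 (y * t) r01; rewrite -/cs in D0.
have ta : 1 - r = t * a by rewrite /a mulVKf ?gt_eqF.
have cs1 : cs <= 1 by exact: cos_le1.
have uE : t * poisson_kernel r (y * t) * (a * a + 2 * r * (t ^- 2 * (1 - cs))) = (1 + r) * a.
  rewrite /poisson_kernel -/cs /a; field.
  by rewrite (gt_eqF t0)/= gt_eqF.
move=> u; rewrite -/u in uE.
have u0 : 0 <= u.
  rewrite mulr_ge0 ?(ltW t0)// divr_ge0 ?(ltW D0)// subr_ge0 expr_le1// ltW//.
have b0 : 0 <= t ^- 2 * (1 - cs) by rewrite mulr_ge0 ?invr_ge0 ?sqr_ge0// subr_ge0.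
have b1 : y ^+ 2 / 10 <= t ^- 2 * (1 - cs).
  rewrite [leRHS]mulrC ler_pdivlMr ?exprn_gt0//; move: c; rewrite exprMn; lra.
split => //.
- have h : u * (a * a) <= 2 * a.
    have : u * (a * a) <= (1 + r) * a.
      by rewrite -uE ler_wpM2l// lerDl (mulr_ge0 _ b0)// mulr_ge0.
    move=> /le_trans; apply; rewrite ler_wpM2r ?(ltW a0)//; lra.
  have h2 : u * a <= 2 by rewrite -(ler_pM2r a0) -mulrA.
  rewrite ler_pdivlMr//.
  have h3 : s <= a * (1 + s).
    have st0 : 0 < 1 + s * t by rewrite ltr_wpDr// ltW// mulr_gt0.
    move: a1; rewrite ler_pdivrMr// => /le_trans; apply.
    by rewrite ler_wpM2l ?(ltW a0)// lerD2l ler_piMr// ltW.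
  apply: (@le_trans _ _ (u * (a * (1 + s)))); first by rewrite ler_wpM2l.
  by rewrite mulrA ler_wpM2r// addr_ge0// ltW.
- have h : u * (2 * r * (y ^+ 2 / 10)) <= 2 * s.
    apply: (@le_trans _ _ ((1 + r) * a)).
      have aa : 0 <= a * a by rewrite mulr_ge0// ltW.
      by rewrite -uE ler_wpM2l// (ler_wpDl aa)// ler_wpM2l// mulr_ge0.
    by rewrite ler_pM ?(ltW a0)// ?addr_ge0//; lra.
  have h2 : r * (u * y ^+ 2) <= 10 * s by lra.
  have h3 : 0 <= u * y ^+ 2 by rewrite mulr_ge0 ?sqr_ge0.
  apply: (@le_trans _ _ ((r * expR s) * (u * y ^+ 2))).
    by rewrite ler_peMl.
  by rewrite mulrAC ler_wpM2r ?expR_ge0.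
Qed.

(* Let m tend to infinity in sum_wrap_poisson. *)
Theorem wrapped_cauchy s x : 0 < s -> `|x| <= pi ->
  series (wrap_term (fun y => 2 * s / (s ^+ 2 + y ^+ 2)) x) n @[n --> \oo] -->
    poisson_kernel (expR (- s)) x.
Proof.
move=> s0 xpi.
pose g m y : R := m.*2.+1%:R^-1 *
    poisson_kernel (expR (- (s / m.*2.+1%:R))) (y / m.*2.+1%:R).
(* At k = 0 the dominating term is C / 2, and the first summand of C suffices. For K = k >= 1 each
   of the two values is at most [10 s expR s / (4 K^2)], and (K + 1) (K + 2) <= 6 K^2 turns their
   sum into the second summand. *)
pose C := 4 * (1 + s) / s + 30 * s * expR s.
have [||||cl cvl] := @tannery R (fun m k => wrap_term (g m) x k)
  (wrap_term (fun y => 2 * s / (s ^+ 2 + y ^+ 2)) x)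
  (fun k => C * (k.+1%:R^-1 * k.+2%:R^-1)) (fun m => m.+1).
- move=> [|k]; first exact: cvg_poisson_kernel_zoom.
  by apply: cvgD; exact: cvg_poisson_kernel_zoom.
- near=> m => -[_|k km].
    have [|u0 u1 _] := @poisson_kernel_zoom_le s x m s0.
      by rewrite (le_trans xpi)// ler_peMr ?pi_ge0// ler1n.
    rewrite ger0_norm// (le_trans u1)// invr1 mul1r.
    have : 0 <= expR s * s by rewrite mulr_ge0 ?expR_ge0// ltW.
    rewrite /C; lra.
  rewrite /wrap_term.
  have k0 : (0 < k.+1)%N by [].
  have km' : pi * k.+1.*2.+1%:R <= pi * m.*2.+1%:R :> R.
    by rewrite ler_pM2l ?pi_gt0// ler_nat ltnS leq_double.
  have /= := cauchy_norm_ge xpi k0 false; rewrite expr0 mul1r => /andP[l1 h1].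
  have /= := cauchy_norm_ge xpi k0 true; rewrite expr1 mulN1r => /andP[l2 h2].
  have [u0 _ u1] := poisson_kernel_zoom_le s0 (le_trans h1 km').
  have [w0 _ w1] := poisson_kernel_zoom_le s0 (le_trans h2 km').
  rewrite -/(g m _) in u0 u1; rewrite -/(g m _) in w0 w1.
  have sq y : 2 * k.+1%:R <= `|y| -> 4 * k.+1%:R ^+ 2 <= y ^+ 2.
    move=> ly; rewrite -[y ^+ 2]real_normK ?num_real//.
    have -> : 4 * k.+1%:R ^+ 2 = (2 * k.+1%:R) ^+ 2 :> R by ring.
    by rewrite lerXn2r ?nnegrE.
  have {}u1 := le_trans (ler_wpM2l u0 (sq _ l1)) u1.
  have {}w1 := le_trans (ler_wpM2l w0 (sq _ l2)) w1.
  rewrite ger0_norm ?addr_ge0//; move: u0 u1 w0 w1.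
  set u := g m _; set w := g m _ => u0 u1 w0 w1.
  rewrite -invfM ler_pdivlMr ?mulr_gt0 ?ltr0n//.
  have K1 : 1 <= k.+1%:R :> R by rewrite ler1n.
  have -> : k.+2%:R = k.+1%:R + 1 :> R by rewrite natr1.
  have -> : k.+3%:R = k.+1%:R + 2 :> R by rewrite -natrD addn2.
  move: (k.+1%:R) K1 u1 w1 => K K1 u1 w1.
  apply: (@le_trans _ _ ((u + w) * (6 * K ^+ 2))).
    by rewrite ler_wpM2l ?addr_ge0//; nra.
  have : 0 <= 4 * (1 + s) / s.
    by rewrite divr_ge0 ?mulr_ge0 ?addr_ge0 ?(ltW s0).
  rewrite /C; lra.
- exact: cvg_series_telescope.
- by [].
have -> : poisson_kernel (expR (- s)) x = limn (series (wrap_term (fun y => 2 * s / (s ^+ 2 + y ^+ 2)) x)).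
  rewrite -(cvg_lim (@Rhausdorff R) cvl); apply/esym/cvg_lim => //.
  under eq_fun do rewrite -(big_mkord xpredT (wrap_term _ x)) sum_wrap_poisson//.
  exact: cvg_cst.
exact: cl.
Unshelve. all: by end_near. Qed.

End cauchy_wrap.

(** * Wrapping the normal density *)

Section binomial_kernel.
Context {R : realType}.
Implicit Types (x y : R) (m k n N X : nat).

(** The binomial expansion of the n-th power of e^(iy) + e^(-iy), in real form: Pascal's rule and
    the product formula for cosines. *)
Lemma cos_expn n y : (2 * cos y) ^+ n =
  \sum_(0 <= i < n.+1) 'C(n, i)%:R * cos ((n%:R - 2 * i%:R) * y).
Proof.
elim: n => [|n IH].
  by rewrite big_nat1 bin0 expr0 mulr0 subr0 mul0r cos0 mulr1.
rewrite exprSr IH big_distrl/=.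
pose c i := cos ((n.+1%:R - 2 * i%:R) * y).
under eq_bigr => i _.
  rewrite (_ : _ * _ * _ = 'C(n, i)%:R * c i + 'C(n, i)%:R * c i.+1); last first.
    rewrite /c.
    have -> : (n.+1%:R - 2 * i%:R) * y = (n%:R - 2 * i%:R) * y + y by ring.
    have -> : (n.+1%:R - 2 * i.+1%:R) * y = (n%:R - 2 * i%:R) * y - y by ring.
    by rewrite cosB cosD; ring.
  over.
rewrite big_split/= [in RHS]big_nat_recl//= bin0.
under [in RHS]eq_bigr do rewrite binS natrD mulrDl -/(c _).
rewrite big_split/= addrA; congr (_ + _).
rewrite big_nat_recl//= bin0 -/(c 0%N); congr (_ + _).
by rewrite big_nat_recr//= bin_small// mul0r addr0.
Qed.

(** The left side is a 2N-th power of [2 cos (x / 2)], whose expansion is symmetric about the index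
    N. Binomials beyond the range vanish, so any length X > N serves, in particular a multiple of
    M. *)
Lemma cos_double_expn N X x : (N < X)%N ->
  (2 + 2 * cos x) ^+ N =
  \sum_(0 <= n < X) cos_term (fun n => 'C(2 * N, N + n)%:R) x n.
Proof.
move=> NX.
have -> : 2 + 2 * cos x = (2 * cos (x / 2)) ^+ 2.
  rewrite [in LHS](_ : x = (x / 2) *+ 2); last by rewrite -mulr_natr; field.
  by rewrite cos_mulr2n; ring.
rewrite -exprM cos_expn.
pose G i := 'C(2 * N, i)%:R * cos ((N%:R - i%:R) * x).
transitivity (\sum_(N - N <= i < N + N.+1) G i).
  rewrite subnn (_ : N + N.+1 = (2 * N).+1)%N; last by rewrite addnS addnn mul2n.
  by apply: eq_bigr => i _; rewrite /G natrM; congr (_ * cos _); field.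
transitivity (\sum_(0 <= n < N.+1) cos_term (fun n => 'C(2 * N, N + n)%:R) x n).
  suff key k : (k <= N)%N -> \sum_(N - k <= i < N + k.+1) G i =
    \sum_(0 <= n < k.+1) cos_term (fun n => 'C(2 * N, N + n)%:R) x n by exact: key.
  elim: k => [_|k IH kN].
    by rewrite subn0 addn1 !big_nat1 /cos_term /G addn0 subrr !mul0r cos0 mul1r.
  rewrite big_nat_recr//= -IH ?(ltnW kN)//.
  rewrite big_ltn; last first.
    by rewrite (@leq_ltn_trans N) ?leq_subr// addnS ltnS leq_addr.
  rewrite subnSK// addnS big_nat_recr/=; last first.
    by rewrite (leq_trans (leq_subr _ _))// leq_addr.
  rewrite addrCA; congr (_ + _); rewrite /cos_term /G natrB// natrD.
  have -> : 'C(2 * N, N - k.+1) = 'C(2 * N, N + k.+1).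
    rewrite -[RHS]bin_sub; last by rewrite mul2n -addnn leq_add2l.
    by congr 'C(_, _); rewrite mul2n -addnn subnDl.
  have -> : (N%:R - (N%:R - k.+1%:R)) * x = k.+1%:R * x by ring.
  have -> : (N%:R - (N%:R + k.+1%:R)) * x = - (k.+1%:R * x) by ring.
  by rewrite cosN; ring.
rewrite (big_cat_nat (n := N.+1) (p := X))//= [X in _ + X]big1_seq ?addr0// => i.
rewrite mem_index_iota => /andP[_ /andP[Ni _]].
rewrite /cos_term bin_small ?mulr0 ?mul0r//.
by rewrite mul2n -addnn ltn_add2l.
Qed.

Definition bin_ratio N k : R := 'C(2 * N, N + k)%:R / 'C(2 * N, N)%:R.

Lemma bin_ratio_ge0 N k : 0 <= bin_ratio N k.
Proof. by rewrite divr_ge0. Qed.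

Lemma bin_mid_neq0 N : 'C(2 * N, N)%:R != 0 :> R.
Proof. by rewrite pnatr_eq0 -lt0n bin_gt0 mul2n -addnn leq_addr. Qed.

Lemma bin_ratio0 N : bin_ratio N 0 = 1.
Proof. by rewrite /bin_ratio addn0 divff// bin_mid_neq0. Qed.

Lemma bin_ratioS N k : (k <= N)%N ->
  bin_ratio N k.+1 = bin_ratio N k * ((N%:R - k%:R) / (N%:R + k.+1%:R)).
Proof.
move=> kN; have := mul_bin_left (2 * N) (N + k).
rewrite mul2n -addnn subnDl -addnS => /(congr1 (fun n : nat => n%:R : R)).
rewrite !natrM natrB// natrD => h.
have Nk0 : N%:R + k.+1%:R != 0 :> R by rewrite -natrD pnatr_eq0 addnS.
rewrite /bin_ratio mul2n -addnn mulrAC; congr (_ / _).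
by apply: (mulfI Nk0); rewrite h [RHS]mulrCA mulrCA; field.
Qed.

(** The i-th factor of the ratio is [(N - i) / (N + i + 1)]. It equals
    [1 - (2 i + 1) / (N + i + 1)], and its inverse equals [1 + (2 i + 1) / (N - i)]; both are
    bounded by exponentials. The exponents add up to k^2 because the odd numbers 2 i + 1 do, the
    denominators being replaced by their extreme values over i < k. *)
Lemma bin_ratio_bounds N k : (k <= N)%N ->
  expR (- (k%:R ^+ 2 / (N%:R - k%:R + 1))) <= bin_ratio N k
    <= expR (- (k%:R ^+ 2 / (N%:R + k%:R))).
Proof.
move=> kN.
suff key i : (i <= k)%N -> expR (- (i%:R ^+ 2 / (N%:R - k%:R + 1))) <= bin_ratio N i
    <= expR (- (i%:R ^+ 2 / (N%:R + k%:R))) by exact: key.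
elim: i => [_|i IH ik].
  by rewrite bin_ratio0 expr0n/= !mul0r oppr0 expR0 lexx.
have iN : (i < N)%N by exact: leq_trans ik kN.
have /andP[l u] := IH (ltnW ik).
have kN' : k%:R <= N%:R :> R by rewrite ler_nat.
have ik' : i%:R + 1 <= k%:R :> R by rewrite natr1 ler_nat.
have i0 : 0 <= i%:R :> R by [].
have D1 : 0 < N%:R - k%:R + 1 :> R by lra.
have D2 : 0 < N%:R + k%:R :> R by lra.
rewrite bin_ratioS ?(ltnW iN)//.
have -> : i.+1%:R ^+ 2 / (N%:R - k%:R + 1) =
  i%:R ^+ 2 / (N%:R - k%:R + 1) + (2 * i%:R + 1) / (N%:R - k%:R + 1) :> R.
  by field; rewrite gt_eqF.
have -> : i.+1%:R ^+ 2 / (N%:R + k%:R) =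
  i%:R ^+ 2 / (N%:R + k%:R) + (2 * i%:R + 1) / (N%:R + k%:R) :> R.
  by field; rewrite gt_eqF.
have D3 : 0 < N%:R + i.+1%:R :> R by rewrite -natr1; lra.
have D4 : 0 < N%:R - i%:R :> R by lra.
have num0 : 0 <= 2 * i%:R + 1 :> R by lra.
rewrite !opprD !expRD; apply/andP; split; apply: ler_pM; rewrite ?expR_ge0//.
- rewrite expRN -[leRHS]invrK lef_pV2 ?posrE ?expR_gt0 ?invr_gt0 ?divr_gt0//.
  apply: (@le_trans _ _ (1 + (2 * i%:R + 1) / (N%:R - k%:R + 1))); last first.
    exact: expR_ge1Dx.
  rewrite invf_div.
  apply: (@le_trans _ _ (1 + (2 * i%:R + 1) / (N%:R - i%:R))).
    by rewrite le_eqVlt; apply/orP; left; apply/eqP; field; rewrite gt_eqF.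
  by rewrite lerD2l ler_wpM2l// lef_pV2 ?posrE//; lra.
- exact: bin_ratio_ge0.
- by rewrite divr_ge0// ltW.
- apply: (@le_trans _ _ (1 + - ((2 * i%:R + 1) / (N%:R + k%:R)))); last first.
    exact: expR_ge1Dx.
  apply: (@le_trans _ _ (1 - (2 * i%:R + 1) / (N%:R + i.+1%:R))).
    by rewrite le_eqVlt; apply/orP; left; apply/eqP; field; apply: lt0r_neq0; lra.
  by rewrite lerD2l lerN2 ler_wpM2l// lef_pV2 ?posrE// -natr1; lra.
Qed.

Lemma sum_wrap_cos_expn N m X x : (N < X * m.*2.+1)%N ->
  \sum_(0 <= k < m.+1) wrap_term (fun y =>
      ((1 + cos (y / m.*2.+1%:R)) / 2) ^+ N) x k =
  m.*2.+1%:R * 4 ^- N * 'C(2 * N, N)%:R *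
    \sum_(0 <= j < X) cos_term (fun j => bin_ratio N (j * m.*2.+1)) x j.
Proof.
move=> NX.
transitivity (4 ^- N * \sum_(0 <= k < m.+1) wrap_term (fun y =>
    \sum_(0 <= n < X * m.*2.+1)
      cos_term (fun n => 'C(2 * N, N + n)%:R) (y / m.*2.+1%:R) n) x k).
  have e (y : R) : ((1 + cos y) / 2) ^+ N = 4 ^- N *
      \sum_(0 <= n < X * m.*2.+1) cos_term (fun n => 'C(2 * N, N + n)%:R) y n.
    rewrite -cos_double_expn// -exprVn -exprMn; congr (_ ^+ _); by field.
  by rewrite big_distrr/=; apply: eq_bigr => -[|k] _; rewrite /wrap_term !e ?mulrDr.
rewrite sum_wrap_trig mulrCA -!mulrA; congr (_ * (_ * _)).
rewrite big_distrr/=; apply: eq_bigr => j _; rewrite /cos_term /bin_ratio.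
have := bin_mid_neq0 N; set B := 'C(2 * N, N)%:R => B0.
by rewrite [RHS]mulrA; congr (_ * _); rewrite mulrCA [B * _]mulrC divfK.
Qed.

End binomial_kernel.

(** * Gaussian bounds for cosine powers and binomial ratios *)

Section gauss_wrap.
Context {R : realType}.
Implicit Types (x y c t rho : R) (m k n N X : nat).

Lemma expR_geometric c : 0 < c ->
  cvgn (series (fun k => 2 * expR (- (c * k%:R)))).
Proof.
move=> c0; rewrite (_ : (fun k => _) = geometric 2 (expR (- c))).
  by apply: is_cvg_geometric_series; rewrite ger0_norm ?expR_ge0// expR_lt1 oppr_lt0.
by apply/funext => k; rewrite /geometric /= -expRM_natl; congr (_ * expR _); ring.
Qed.

(** With q = (y t)^2 / 4 the base is at least 1 - q, and 1 / (1 - q) = 1 + q / (1 - q) is at most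
    [expR (q / (1 - q))]. *)
Lemma cos_sqr_ge y N t c : `|y * t| <= pi -> (y * t) ^+ 2 < 4 -> 0 < t ->
  N%:R * t ^+ 2 <= c ->
  expR (- (c * y ^+ 2 / 4 / (1 - (y * t) ^+ 2 / 4)))
    <= ((1 + cos (y * t)) / 2) ^+ N.
Proof.
move=> ytpi yt4 t0 Nc.
have D0 : 0 < 1 - (y * t) ^+ 2 / 4 by lra.
set q := (y * t) ^+ 2 / 4 in D0 *.
have h : expR (- (q / (1 - q))) <= (1 + cos (y * t)) / 2.
  have e : (y * t) ^+ 2 / 2 = 2 * q by rewrite /q; field.
  have := @cos_ge_quad R (y * t); rewrite e => hc.
  apply: (@le_trans _ _ (1 - q)); last by lra.
  rewrite expRN -[leRHS]invrK lef_pV2 ?posrE ?expR_gt0 ?invr_gt0//.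
  apply: le_trans (expR_ge1Dx _).
  by rewrite le_eqVlt; apply/orP; left; apply/eqP; field; rewrite gt_eqF.
apply: (@le_trans _ _ (expR (- (q / (1 - q))) ^+ N)); last first.
  by rewrite lerXn2r ?nnegrE ?expR_ge0// (le_trans _ h)// expR_ge0.
rewrite -expRM_natl ler_expR mulrN lerN2 mulrA ler_wpM2r ?invr_ge0 ?(ltW D0)//.
rewrite /q exprMn mulrA ler_wpM2r// mulrCA mulrC ler_wpM2r ?sqr_ge0//.
Qed.

(** The base is the square of [cos (y t / 2)], and the halved angle lies in the range of the
    Gaussian bound for the cosine. *)
Lemma cos_sqr_le y N t c : `|y * t| <= pi -> c - t ^+ 2 <= N%:R * t ^+ 2 ->
  0 <= ((1 + cos (y * t)) / 2) ^+ N <= expR (- ((c - t ^+ 2) * y ^+ 2 / 4)).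
Proof.
move=> ytpi cN.
have -> : (1 + cos (y * t)) / 2 = cos (y * t / 2) ^+ 2.
  rewrite [in LHS](_ : y * t = (y * t / 2) *+ 2); last by rewrite -mulr_natr; field.
  by rewrite cos_mulr2n; field.
rewrite exprn_ge0 ?sqr_ge0//=.
have yt2 : `|y * t / 2| <= pi / 2.
  by rewrite normrM [`|2^-1|]gtr0_norm// ler_pM2r.
have c0 : 0 <= cos (y * t / 2) by rewrite cos_ge0_pihalf -?ler_norml.
rewrite -exprM.
apply: (@le_trans _ _ (expR (- ((y * t / 2) ^+ 2 / 2)) ^+ (2 * N))).
  by rewrite lerXn2r ?nnegrE ?expR_ge0// cos_le_expR.
rewrite -expRM_natl ler_expR mulrN lerN2.
rewrite (_ : _ * (_ / 2) = N%:R * t ^+ 2 * (y ^+ 2 / 4)); last by rewrite natrM; field.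
by rewrite -mulrA ler_wpM2r// divr_ge0// sqr_ge0.
Qed.

(** Domination: with K = j M <= N, the exponent K^2 / (N + K) is at least K^2 / (2 N) >= j^2 / (2 c)
    >= j / (2 c). For K > N the ratio is 0. *)
Lemma bin_ratio_le N t c j M : (0 < M)%N -> t = M%:R^-1 -> N%:R * t ^+ 2 <= c ->
  0 < c ->
  0 <= bin_ratio N (j * M) :> R /\
  bin_ratio N (j * M) <= expR (- (j%:R / (2 * c))) :> R.
Proof.
move=> M0 tE Nc c0; split; first exact: bin_ratio_ge0.
have M0' : M%:R != 0 :> R by rewrite pnatr_eq0 -lt0n.
have t0 : 0 < t by rewrite tE invr_gt0 ltr0n.
case: (leqP (j * M) N) => jN; last first.
  rewrite /bin_ratio bin_small ?mul0r ?expR_ge0//.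
  by rewrite mul2n -addnn ltn_add2l.
have /andP[_ h] := bin_ratio_bounds (R := R) jN; rewrite (le_trans h)//.
rewrite ler_expR lerN2.
case: j => [|j] in jN h *; first by rewrite mul0r mulr_ge0 ?invr_ge0 ?addr_ge0.
have jM0 : 0 < (j.+1 * M)%:R :> R by rewrite ltr0n muln_gt0 M0.
have jN' : (j.+1 * M)%:R <= N%:R :> R by rewrite ler_nat.
have j1 : 1 <= j.+1%:R :> R by rewrite ler1n.
have NM : N%:R <= c * M%:R ^+ 2.
  by move: Nc; rewrite tE exprVn ler_pdivrMr// exprn_gt0// ltr0n.
rewrite ler_pdivlMr ?addr_gt0//; last exact: lt_le_trans jN'.
rewrite mulrAC ler_pdivrMr ?mulr_gt0//.
apply: (@le_trans _ _ (j.+1%:R * (2 * (c * M%:R ^+ 2)))).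
  by rewrite ler_wpM2l//; lra.
rewrite natrM exprMn.
have M2 : 0 <= c * M%:R ^+ 2 by rewrite mulr_ge0 ?sqr_ge0// ltW.
have -> : j.+1%:R ^+ 2 * M%:R ^+ 2 * (2 * c) = j.+1%:R ^+ 2 * (2 * (c * M%:R ^+ 2)) by ring.
apply: ler_wpM2r; first by rewrite mulr_ge0.
by rewrite expr2 ler_peMr.
Qed.

(** Multiply numerator and denominator of the exponents of [bin_ratio_bounds] by t^2: with K = j M,
    (K t)^2 is j^2, and N t^2 is c up to an error below t^2. The condition j t < c ensures K <=
    N. *)
Lemma bin_ratio_squeeze N t c j M : (0 < M)%N -> t = M%:R^-1 -> N%:R * t ^+ 2 <= c ->
  c < (N%:R + 1) * t ^+ 2 -> j%:R * t < c ->
  expR (- (j%:R ^+ 2 / (c - j%:R * t))) <= bin_ratio N (j * M)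
    <= expR (- (j%:R ^+ 2 / (c + j%:R * t))).
Proof.
move=> M0 tE Nc cN jtc.
have M0' : 0 < M%:R :> R by rewrite ltr0n.
have t0 : 0 < t by rewrite tE invr_gt0.
have Mt : M%:R * t = 1 by rewrite tE divff// gt_eqF.
have jN : (j * M <= N)%N.
  rewrite -ltnS -(ltr_nat R) natrM -natr1 -(ltr_pM2r (exprn_gt0 2 t0)).
  rewrite (le_lt_trans _ cN)// expr2 mulrA -(mulrA j%:R) Mt mulr1 ltW//.
have j0 : 0 <= j%:R * t by rewrite mulr_ge0// ltW.
have /andP[l u] := bin_ratio_bounds (R := R) jN.
have jE : (j * M)%:R * t = j%:R by rewrite natrM -mulrA Mt mulr1.
have jN' : (j * M)%:R <= N%:R :> R by rewrite ler_nat.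
have c0 : 0 < c by rewrite (le_lt_trans j0).
move: ((j * M)%:R) (bin_ratio _ _) jE jN' l u => K b jE KN l u.
have K0 : 0 <= K by rewrite -(pmulr_lge0 _ t0) jE.
apply/andP; split.
- rewrite (le_trans _ l)// ler_expR lerN2.
  have D : 0 < N%:R - K + 1 by lra.
  have -> : K ^+ 2 / (N%:R - K + 1) = j%:R ^+ 2 / ((N%:R - K + 1) * t ^+ 2).
    by rewrite -jE; field; rewrite !gt_eqF.
  rewrite ler_wpM2l ?sqr_ge0// lef_pV2 ?posrE ?mulr_gt0 ?exprn_gt0 ?subr_gt0//.
  by rewrite -jE; nra.
- rewrite (le_trans u)// ler_expR lerN2.
  have [Ke|Kn0] := eqVneq K 0; first by rewrite -jE Ke mul0r expr0n !mul0r.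
  have K0' : 0 < K by rewrite lt_def Kn0.
  have -> : K ^+ 2 / (N%:R + K) = j%:R ^+ 2 / ((N%:R + K) * t ^+ 2).
    by rewrite -jE; field; rewrite !gt_eqF//; lra.
  rewrite ler_wpM2l ?sqr_ge0// lef_pV2 ?posrE ?mulr_gt0 ?exprn_gt0//; try lra.
  by rewrite -jE; nra.
Qed.

End gauss_wrap.

(** * The limit for the normal density *)

Section gauss_wrap.
Context {R : realType}.
Implicit Types (x y c t rho : R) (m k n N X : nat).

Let t m : R := m.*2.+1%:R^-1.
(** The largest N with N t^2 <= c; the normal law of variance rho corresponds to c = 2 / rho. *)
Let N c m : nat := Num.trunc (c / t m ^+ 2).

Let t_gt0 m : 0 < t m. Proof. by rewrite invr_gt0 ltr0n. Qed.

Let N_bounds c m : 0 < c ->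
  (N c m)%:R * t m ^+ 2 <= c /\ c < ((N c m)%:R + 1) * t m ^+ 2.
Proof.
move=> c0; have t2 : 0 < t m ^+ 2 by rewrite exprn_gt0.
have := @truncn_itv R (c / t m ^+ 2); rewrite divr_ge0 ?(ltW c0) ?(ltW t2)//.
move=> /(_ isT)/andP[h1 h2]; split; first by rewrite -ler_pdivlMr.
by rewrite -ltr_pdivrMr// natr1.
Qed.

Let cvg_t (y : R) : y * t m @[m --> \oo] --> (0 : R).
Proof.
have e : y * 0 = 0 by rewrite mulr0.
rewrite -[X in _ --> X]e; apply: cvgM; [exact: cvg_cst|exact: cvg_inv_odd].
Qed.

Lemma cvg_cos_expn c y : 0 < c ->
  ((1 + cos (y * t m)) / 2) ^+ N c m @[m --> \oo] --> expR (- (c * y ^+ 2 / 4)).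
Proof.
move=> c0; apply: (@squeeze_cvgr _ _ _ _
  (fun m => expR (- (c * y ^+ 2 / 4 / (1 - (y * t m) ^+ 2 / 4))))
  (fun m => expR (- ((c - t m ^+ 2) * y ^+ 2 / 4)))).
- near=> m.
  have [h1 h2] := N_bounds m c0.
  have yt : `|y * t m| < 2.
    by near: m; apply: cvgr0_norm_lt => //; exact: cvg_t.
  have ytpi : `|y * t m| <= pi by rewrite (le_trans (ltW yt))// pi_ge2.
  rewrite cos_sqr_ge//=; last first.
    rewrite -real_normK ?num_real// (_ : 4 = 2 ^+ 2); last by ring.
    by rewrite ltrXn2r ?nnegrE.
  have h3 : c - t m ^+ 2 <= (N c m)%:R * t m ^+ 2 by lra.
  by have /andP[] := cos_sqr_le ytpi h3.
- apply: continuous_cvg; first exact: continuous_expR.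
  apply: cvgN.
  have e : c * y ^+ 2 / 4 / (1 - 0 * 0 / 4) = c * y ^+ 2 / 4 by rewrite !mul0r subr0 divr1.
  rewrite -[X in _ --> X]e.
  apply: cvgM; first exact: cvg_cst.
  apply: cvgV; first by rewrite !mul0r subr0 oner_neq0.
  apply: cvgB; [exact: cvg_cst|apply: cvgM; [|exact: cvg_cst]].
  by apply: cvgM; exact: cvg_t.
- apply: continuous_cvg; first exact: continuous_expR.
  apply: cvgN.
  have e : (c - 0 * 0) * y ^+ 2 / 4 = c * y ^+ 2 / 4 by rewrite mul0r subr0.
  rewrite -[X in _ --> X]e.
  apply: cvgM; last exact: cvg_cst.
  apply: cvgM; last exact: cvg_cst.
  by apply: cvgB; [exact: cvg_cst|apply: cvgM; exact: cvg_inv_odd].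
Unshelve. all: by end_near. Qed.

Lemma cvg_bin_ratio c j : 0 < c ->
  bin_ratio (N c m) (j * m.*2.+1) @[m --> \oo] --> expR (- (j%:R ^+ 2 / c)).
Proof.
move=> c0; apply: (@squeeze_cvgr _ _ _ _
  (fun m => expR (- (j%:R ^+ 2 / (c - j%:R * t m))))
  (fun m => expR (- (j%:R ^+ 2 / (c + j%:R * t m))))).
- near=> m; have [h1 h2] := N_bounds m c0.
  apply: bin_ratio_squeeze => //.
  near: m; apply: (cvgr_lt 0) => //; exact: cvg_t.
- apply: continuous_cvg; first exact: continuous_expR.
  apply: cvgN; apply: cvgM; first exact: cvg_cst.
  apply: cvgV; first by rewrite gt_eqF.
  rewrite -[X in _ --> X]subr0; apply: cvgB; [exact: cvg_cst|exact: cvg_t].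
- apply: continuous_cvg; first exact: continuous_expR.
  apply: cvgN; apply: cvgM; first exact: cvg_cst.
  apply: cvgV; first by rewrite gt_eqF.
  rewrite -[X in _ --> X]addr0; apply: cvgD; [exact: cvg_cst|exact: cvg_t].
Unshelve. all: by end_near. Qed.

Lemma cvg_sum_wrap_cos_expn c x : 0 < c -> `|x| <= pi ->
  let f := wrap_term (fun y => expR (- (c * y ^+ 2 / 4))) x in
  cvgn (series f) /\
  \sum_(0 <= k < m.+1) wrap_term (fun y => ((1 + cos (y * t m)) / 2) ^+ N c m) x k
    @[m --> \oo] --> limn (series f).
Proof.
move=> c0 xpi f.
(* Once t^2 <= c / 2, each value is at most [expR (- (c / 2 * y ^+ 2 / 4))], and |y| >= 2 k makes
   the exponent at least c k^2 / 2 >= c k / 2. *)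
have [||||cl cvl] := @tannery R
  (fun m => wrap_term (fun y => ((1 + cos (y * t m)) / 2) ^+ N c m) x)
  f (fun k => 2 * expR (- (c / 2 * k%:R))) (fun m => m.+1).
- move=> [|k]; first exact: cvg_cos_expn.
  by apply: cvgD; exact: cvg_cos_expn.
- near=> m => k km; have [h1 h2] := N_bounds m c0.
  have h3 : c - t m ^+ 2 <= (N c m)%:R * t m ^+ 2 by lra.
  have tc : t m ^+ 2 <= c / 2.
    near: m; have h : t m * t m @[m --> \oo] --> (0 * 0 : R).
      by apply: cvgM; exact: cvg_inv_odd.
    rewrite mul0r in h; apply: (cvgr_le _ h); by rewrite divr_gt0.
  have key y : `|y| <= pi * m.*2.+1%:R -> 2 * k%:R <= `|y| ->
      0 <= ((1 + cos (y * t m)) / 2) ^+ N c m <= expR (- (c / 2 * k%:R)).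
    move=> yM yk; have ytpi : `|y * t m| <= pi.
      by rewrite normrM [`|t m|]gtr0_norm// ler_pdivrMr ?ltr0n.
    have /andP[-> h] := cos_sqr_le ytpi h3; rewrite (le_trans h)//=.
    rewrite ler_expR lerN2.
    have y2 : 4 * k%:R ^+ 2 <= y ^+ 2.
      rewrite -[y ^+ 2]real_normK ?num_real//.
      have -> : 4 * k%:R ^+ 2 = (2 * k%:R) ^+ 2 :> R by ring.
      by rewrite lerXn2r ?nnegrE// mulr_ge0.
    have kk : k%:R <= k%:R ^+ 2 :> R.
      by rewrite -natrX ler_nat -mulnn; case: (k) => // i; rewrite leq_pmull.
    apply: (@le_trans _ _ (c / 2 * y ^+ 2 / 4)).
      by rewrite -[leRHS]mulrA ler_wpM2l ?divr_ge0 ?(ltW c0)//; lra.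
    by rewrite ler_wpM2r// ler_wpM2r ?sqr_ge0//; lra.
  case: k => [|k] in km key *; rewrite /wrap_term.
    have /andP[h0 h4] : 0 <= ((1 + cos (x * t m)) / 2) ^+ N c m <= expR (- (c / 2 * 0)).
      by apply: key; rewrite ?mulr0// (le_trans xpi)// ler_peMr ?pi_ge0// ler1n.
    by rewrite ger0_norm// (le_trans h4)// ler_peMl ?expR_ge0// ler1n.
  have km' : pi * k.+1.*2.+1%:R <= pi * m.*2.+1%:R :> R.
    by rewrite ler_pM2l ?pi_gt0// ler_nat ltnS leq_double.
  have k0 : (0 < k.+1)%N by [].
  have /= := cauchy_norm_ge xpi k0 false; rewrite expr0 mul1r => /andP[l1 e1].
  have /= := cauchy_norm_ge xpi k0 true; rewrite expr1 mulN1r => /andP[l2 e2].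
  have /andP[a1 b1] := key _ (le_trans e1 km') l1.
  have /andP[a2 b2] := key _ (le_trans e2 km') l2.
  by rewrite ger0_norm ?addr_ge0// [leRHS]mulr_natl mulr2n lerD.
- by apply: expR_geometric; rewrite divr_gt0.
- by [].
split => //; under eq_fun do rewrite big_mkord; exact: cvl.
Unshelve. all: by end_near. Qed.

(** The length exceeds [N c m], so that the finite cosine expansion is complete, and m, as required
    by [tannery]. *)
Lemma cvg_sum_bin_ratio c x : 0 < c ->
  let f := cos_term (fun j => expR (- (j%:R ^+ 2 / c))) x in
  cvgn (series f) /\
  \sum_(0 <= j < N c m + m.+1) cos_term (fun j => bin_ratio (N c m) (j * m.*2.+1)) x j
    @[m --> \oo] --> limn (series f).
Proof.
move=> c0 f.
have [||||cl cvl] := @tannery R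
  (fun m => cos_term (fun j => bin_ratio (N c m) (j * m.*2.+1)) x)
  f (fun k => 2 * expR (- ((2 * c)^-1 * k%:R))) (fun m => N c m + m.+1)%N.
- move=> j; apply: cvgM; last exact: cvg_cst.
  by apply: cvgM; [exact: cvg_cst|exact: cvg_bin_ratio].
- near=> m => j _; have [h1 h2] := N_bounds m c0.
  have [b0 b1] := @bin_ratio_le R (N c m) (t m) c j m.*2.+1 isT erefl h1 c0.
  rewrite /cos_term normrM [`|_ * bin_ratio _ _|]normrM (ger0_norm b0) -mulrA.
  apply: ler_pM => //; first by rewrite mulr_ge0.
    by case: j {b0 b1} => [|j]; rewrite ger0_norm// ?ler1n.
  rewrite -[leRHS]mulr1 ler_pM// ?cos_max//.
  by rewrite mulrC.
- by apply: expR_geometric; rewrite invr_gt0 mulr_gt0.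
- by move=> m; rewrite (leq_trans (leqnSn m))// leq_addl.
split => //; under eq_fun do rewrite big_mkord; exact: cvl.
Unshelve. all: by end_near. Qed.

Lemma series_ge_first (u : nat -> R) : (forall n, 0 <= u n) ->
  cvgn (series u) -> u 0%N <= limn (series u).
Proof.
move=> u0 cu; have -> : u 0%N = series u 1%N by rewrite /series/= big_nat1.
apply: nondecreasing_cvgn_le => //.
by apply: nondecreasing_series => n _ _.
Qed.

(* The constant is not computed here: it is determined afterwards by
   integrating both sides. *)
Theorem wrapped_gauss rho : 0 < rho -> exists2 K, 0 < K &
  forall x, `|x| <= pi ->
  series (wrap_term (fun y => expR (- (y ^+ 2 / (2 * rho)))) x) n @[n --> \oo] -->
  K * limn (series (cos_term (fun n => expR (- (n%:R ^+ 2 * rho / 2))) x)).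
Proof.
(* This c gives c / 4 = 1 / (2 rho) on the side of the density and 1 / c = rho / 2 on the side of
   the coefficients. *)
move=> rho0; pose c := 2 / rho; have c0 : 0 < c by rewrite divr_gt0.
have -> : (fun y => expR (- (y ^+ 2 / (2 * rho)))) = fun y => expR (- (c * y ^+ 2 / 4)).
  by apply/funext => y; congr (expR (- _)); rewrite /c; field; rewrite gt_eqF.
have -> : (fun n : nat => expR (- (n%:R ^+ 2 * rho / 2))) =
    fun j => expR (- (j%:R ^+ 2 / c)).
  by apply/funext => y; congr (expR (- _)); rewrite /c; field; rewrite gt_eqF.
pose L m x := \sum_(0 <= k < m.+1)
  wrap_term (fun y => ((1 + cos (y * t m)) / 2) ^+ N c m) x k.
pose T m x := \sum_(0 <= j < N c m + m.+1)
  cos_term (fun j => bin_ratio (N c m) (j * m.*2.+1)) x j.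
pose K m := m.*2.+1%:R * 4 ^- N c m * 'C(2 * N c m, N c m)%:R : R.
have LT m x : L m x = K m * T m x.
  apply: sum_wrap_cos_expn; rewrite (leq_trans _ (leq_pmulr _ _))//.
  by rewrite addnS ltnS leq_addr.
set F := wrap_term (fun y => expR (- (c * y ^+ 2 / 4))).
set G := cos_term (fun j => expR (- (j%:R ^+ 2 / c))).
have pi0 : `|0 : R| <= pi by rewrite normr0 pi_ge0.
have [cF0 cL0] := cvg_sum_wrap_cos_expn c0 pi0.
have [cG0 cT0] := cvg_sum_bin_ratio 0 c0.
rewrite -/F in cF0 cL0; rewrite -/G in cG0 cT0.
have G1 : 1 <= limn (series (G 0)).
  rewrite (le_trans _ (series_ge_first _ cG0))//.
    by rewrite /G /cos_term expr0n mul0r oppr0 expR0 mulr0 cos0 !mulr1.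
  by move=> j; rewrite /G /cos_term mulr0 cos0 mulr1 mulr_ge0 ?expR_ge0//; case: j.
have F1 : 1 <= limn (series (F 0)).
  rewrite (le_trans _ (series_ge_first _ cF0))//.
    by rewrite /F /wrap_term expr0n mulr0 mul0r oppr0 expR0.
  by case=> [|k]; rewrite /F /wrap_term ?addr_ge0 ?expR_ge0.
have T1 m : 1 <= T m 0.
  rewrite /T big_ltn ?addnS// {1}/cos_term mul0n bin_ratio0 mulr0 cos0 !mulr1.
  rewrite lerDl sumr_ge0// => j _; rewrite /cos_term mulr0 cos0 mulr1.
  by rewrite mulr_ge0 ?bin_ratio_ge0//; case: j.
(* Instead of asymptotics of the central binomial coefficient, the limit of [K m] is read off from
   the identity at x = 0: there both sums converge and [T m 0 >= 1] permits the division. *)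
have cK : K m @[m --> \oo] --> limn (series (F 0)) / limn (series (G 0)).
  rewrite (_ : K = fun m => L m 0 / T m 0); last first.
    by apply/funext => m; rewrite LT mulfK// gt_eqF// (lt_le_trans _ (T1 m)).
  apply: cvgM => //; apply: cvgV => //.
  by rewrite gt_eqF// (lt_le_trans _ G1).
exists (limn (series (F 0)) / limn (series (G 0))).
  by rewrite divr_gt0// (lt_le_trans _ G1, lt_le_trans _ F1).
move=> x xpi.
have [cFx cLx] := cvg_sum_wrap_cos_expn c0 xpi.
have [cGx cTx] := cvg_sum_bin_ratio x c0.
suff <- : limn (series (F x)) = limn (series (F 0)) / limn (series (G 0)) * limn (series (G x)).
  exact: cFx.
rewrite -(cvg_lim (@Rhausdorff R) cLx); apply/cvg_lim => //.
under eq_fun do rewrite -/(L _ x) LT.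
exact: cvgM.
Qed.

End gauss_wrap.

(** * Integration over the circle *)

Section affine.
Context {R : realType}.
Local Notation mu := (@lebesgue_measure R).
Variables (a b : R).

Definition affine (x : measurableTypeR R) : measurableTypeR R := a * x + b.

Lemma measurable_affine : measurable_fun setT affine.
Proof. by apply: measurable_funD => //; exact: measurable_funM. Qed.

HB.instance Definition _ :=
  isMeasurableFun.Build _ _ _ _ affine measurable_affine.

(** By uniqueness of Lebesgue measure, it is a times its own image under the affine map, since the
    two agree on half-open intervals. *)
Lemma ge0_integral_affine (f : measurableTypeR R -> \bar R) : 0 < a ->
  measurable_fun setT f -> (forall x, (0 <= f x)%E) ->
  (\int[mu]_x f x = a%:E * \int[mu]_x f (a * x + b)%R)%E.
Proof.
move=> a0 mf f0.
pose na : {nonneg R} := NngNum (ltW a0).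
pose push :
  {measure set (measurableTypeR R) -> \bar R} := pushforward mu affine.
transitivity (\int[mscale na (push measurable_affine)]_x f x)%E.
  apply: eq_measure_integral => A mA _.
  apply: lebesgue_measure_unique => //= _ [[u v] _ <-].
  rewrite /mscale /push/= /pushforward.
  rewrite (_ : _ @^-1` _ = `](u - b) / a, (v - b) / a]%classic); last first.
    apply/seteqP; split => x /=; rewrite !in_itv/= /affine;
    by rewrite ltr_pdivrMr// ler_pdivlMr// ltrBlDr lerBrDr mulrC.
  rewrite !lebesgue_measure_itv/= !lte_fin ltr_pM2r ?invr_gt0// ltrD2r.
  case: ifPn => _; last by rewrite mule0.
  by rewrite -!EFinB -EFinM; congr EFin; field; rewrite gt_eqF.
rewrite ge0_integral_mscale//=.
by rewrite ge0_integral_pushforward.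
Qed.

End affine.

Section wrap.
Context {R : realType}.
Local Notation mu := (@lebesgue_measure R).
Implicit Types (g w : measurableTypeR R -> \bar R).

Lemma ge0_integral_shift g (b u v : R) :
  measurable_fun setT g -> (forall x, (0 <= g x)%E) ->
  (\int[mu]_(x in `[(u + b)%R, (v + b)%R[) g x =
   \int[mu]_(x in `[u, v[) g (x + b)%R)%E.
Proof.
move=> mg g0; rewrite integral_mkcond (ge0_integral_affine b (@ltr01 R)).
- rewrite mul1e [RHS]integral_mkcond; apply: eq_integral => x _.
  rewrite mul1r /patch.
  rewrite (_ : (x + b \in _) = (x \in `[u, v[%classic)) //.
  by rewrite !mem_setE !in_itv/= lerD2r ltrD2r.
- by apply/(measurable_restrictT _ _).1 => //; exact: measurable_funTS.
- by move=> x; apply: erestrict_ge0 => y _; exact: g0.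
Qed.

Definition ewrap_term g (x : R) (k : nat) : \bar R :=
  if k is 0 then g x
  else (g (x + 2 * pi * k%:R)%R + g (x - 2 * pi * k%:R)%R)%E.

(** The centred windows [E n] consist of 2n + 1 periods. Passing to the next one adds one translate
    on either side, which is one [ewrap_term], and monotone convergence exhausts the line. *)
Lemma integral_wrap g : measurable_fun setT g -> (forall x, (0 <= g x)%E) ->
  (\int[mu]_x g x =
   \int[mu]_(x in `[(- pi)%R, pi[) \sum_(k <oo) ewrap_term g x k)%E.
Proof.
move=> mg g0; have mgs (b : R) : measurable_fun setT (fun x : measurableTypeR R => g (x + b)).
  by apply: measurableT_comp => //; exact: measurable_funD.
have mw k : measurable_fun setT (fun x : measurableTypeR R => ewrap_term g x k).
  by case: k => [//|k]; apply: emeasurable_funD; exact: mgs.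
have w0 k x : (0 <= ewrap_term g x k)%E.
  by case: k => [|k]; [exact: g0|apply: adde_ge0; exact: g0].
rewrite integral_nneseries//; last first.
  by move=> k; exact: measurable_funTS.
pose E (n : nat) : set R := `[- (pi * n.*2.+1%:R), pi * n.*2.+1%:R[%classic.
have EE n : (\int[mu]_(x in E n) g x =
    \sum_(0 <= k < n.+1) \int[mu]_(x in `[(- pi)%R, pi[) ewrap_term g x k)%E.
  elim: n => [|n IH]; first by rewrite big_nat1 /E mulr1.
  rewrite big_nat_recr//= -IH.
  have pi0 := @pi_gt0 R.
  have n0 : 0 <= pi * n%:R :> R by rewrite mulr_ge0// ltW.
  have e1 : pi * n.*2.+1%:R = 2 * (pi * n%:R) + pi :> R.
    by rewrite -natr1 -muln2 natrM; ring.
  have e2 : pi * n.+1.*2.+1%:R = 2 * (pi * n%:R) + 3 * pi :> R.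
    by rewrite -natr1 -muln2 natrM -natr1; ring.
  have e3 : 2 * pi * n.+1%:R = 2 * (pi * n%:R) + 2 * pi :> R.
    by rewrite -natr1; ring.
  rewrite /E e1 e2 e3; move: (pi * n%:R) n0 => r r0 {e1 e2 e3 IH}.
  rewrite ge0_integralD//=; last 2 first.
  - exact: measurable_funTS (mgs _).
  - exact: measurable_funTS (mgs _).
  rewrite -!(ge0_integral_shift _ _ _ mg g0).
  rewrite [in RHS]addeA -ge0_integral_setU//=; last 2 first.
  - exact: measurable_funTS.
  - apply/disj_setPS => x /=; rewrite !in_itv/= => -[/andP[? ?] /andP[? ?]]; lra.
  rewrite -ge0_integral_setU//=; last 3 first.
  - exact: measurableU.
  - exact: measurable_funTS.
  - apply/disj_setPS => x /=; rewrite !in_itv/= => -[[/andP[? ?]|/andP[? ?]] /andP[? ?]]; lra.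
  congr (integral _ _ _); apply/seteqP; split => x /=; rewrite !in_itv/=.
    move=> /andP[x1 x2].
    have [h1|h1] := ltP x (- (2 * r + pi)).
      by right; apply/andP; split; lra.
    have [h2|h2] := ltP x (2 * r + pi).
      by left; left; apply/andP; split; lra.
    by left; right; apply/andP; split; lra.
  by move=> [[/andP[x1 x2]|/andP[x1 x2]]|/andP[x1 x2]]; apply/andP; split; lra.
have EU : \bigcup_n E n = setT.
  rewrite -subTset => x _; exists (Num.trunc `|x|) => //.
  have /andP[_ h] := truncn_itv (normr_ge0 x).
  rewrite /E /= in_itv/=.
  have : `|x| < pi * (Num.trunc `|x|).*2.+1%:R.
    rewrite (lt_le_trans h)//.
    apply: (@le_trans _ _ (1 * (Num.trunc `|x|).*2.+1%:R)).
      by rewrite mul1r ler_nat ltnS -addnn leq_addr.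
    by rewrite ler_wpM2r// (le_trans _ (@pi_ge2 R))// ler1n.
  by rewrite ltr_norml => /andP[/ltW-> ->].
have /cvg_lim <- // : (\int[mu]_(x in E n) g x @[n --> \oo] --> \int[mu]_x g x)%E.
  rewrite -EU; apply: ge0_nondecreasing_set_cvg_integral => //.
  - apply/nondecreasing_seqP => n; rewrite subsetEset => x /=.
    rewrite /E /= !in_itv/= => /andP[x1 x2].
    have : pi * n.*2.+1%:R <= pi * n.+1.*2.+1%:R :> R.
      by rewrite ler_pM2l ?pi_gt0// ler_nat ltnS leq_double.
    by move=> ?; apply/andP; split; lra.
  - by move=> n; exact: measurable_itv.
  - by move=> n; exact: measurable_funTS.
under eq_fun do rewrite EE.
apply/cvg_lim => //.
rewrite (cvg_shiftS (fun n => (\sum_(0 <= k < n)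
  \int[mu]_(x in `[(- pi)%R, pi[) ewrap_term g x k)%E)).
apply: is_cvg_nneseries => n _ _.
by apply: integral_ge0.
Qed.

End wrap.

(** * Integrals over a period *)

Section periodic_integral.
Context {R : realType}.
Local Notation mu := (@lebesgue_measure R).
Variable w : measurableTypeR R -> \bar R.
Hypotheses (w_periodic : forall x : R, w (x + 2 * pi) = w x)
  (mw : measurable_fun setT w) (w_ge0 : forall x, (0 <= w x)%E).

Lemma periodicDn x n : w (x + 2 * pi * n%:R) = w x.
Proof.
elim: n => [|n IH]; first by rewrite mulr0 addr0.
by rewrite -[n.+1%:R]natr1 mulrDr mulr1 addrA w_periodic.
Qed.

Lemma periodicBn x n : w (x - 2 * pi * n%:R) = w x.
Proof. by rewrite -(periodicDn _ n) subrK. Qed.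

(** Reduce a modulo 2 pi; the part of the shifted window beyond pi is then moved back by one
    period. *)
Lemma integral_period_shift (a : R) :
  (\int[mu]_(x in `[(- pi)%R, pi[) w (x + a)%R =
   \int[mu]_(x in `[(- pi)%R, pi[) w x)%E.
Proof.
have pi0 := @pi_gt0 R; have pi2 := @pi_ge2 R.
wlog : a / 0 <= a < 2 * pi => [hw|/andP[a0 a2]].
  pose n := (Num.trunc `|a|).+1.
  have an : 0 <= a + 2 * pi * n%:R.
    have /andP[_ h] := truncn_itv (normr_ge0 a).
    have := ler_norm (- a); rewrite normrN => h2.
    have : 0 <= n%:R :> R by []. 
    by rewrite -/n in h; nra.
  have := @truncn_itv R ((a + 2 * pi * n%:R) / (2 * pi)).
  rewrite divr_ge0//; last by rewrite mulr_ge0// ltW.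
  set k := Num.trunc _ => /(_ isT)/andP[k1 k2].
  rewrite ler_pdivlMr ?mulr_gt0// in k1; rewrite ltr_pdivrMr ?mulr_gt0// in k2.
  rewrite -(hw (a + 2 * pi * n%:R - 2 * pi * k%:R)).
    by apply: eq_integral => x _; rewrite !addrA periodicBn periodicDn.
  by rewrite -natr1 in k2; apply/andP; split; nra.
rewrite -ge0_integral_shift//.
rewrite (_ : `[- pi + a, pi + a[%classic =
    `[- pi + a, pi[%classic `|` `[pi, pi + a[%classic); last first.
  apply/seteqP; split => x /=; rewrite !in_itv/=.
    move=> /andP[x1 x2]; case: (ltP x pi) => h; [left|right]; apply/andP; split; lra.
  by move=> [|] /andP[x1 x2]; apply/andP; split; lra.
rewrite ge0_integral_setU//=; last 2 first.
- exact: measurable_funTS.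
- apply/disj_setPS => x /=; rewrite !in_itv/= => -[/andP[? ?] /andP[? ?]]; lra.
rewrite [X in (_ + X)%E](_ : _ = \int[mu]_(x in `[(- pi)%R, (a - pi)%R[) w x)%E; last first.
  rewrite (_ : `[pi, pi + a[%classic =
      `[(- pi + 2 * pi)%R, (a - pi + 2 * pi)%R[%classic); last first.
    have e1 : pi = - pi + 2 * pi :> R by ring.
    have e2 : pi + a = a - pi + 2 * pi by ring.
    by rewrite -e1 -e2.
  rewrite ge0_integral_shift//.
  by apply: eq_integral => x _; rewrite w_periodic.
rewrite addeC -ge0_integral_setU//=.
- congr (integral _ _ _); apply/seteqP; split => x /=; rewrite !in_itv/=.
    by move=> [|] /andP[x1 x2]; apply/andP; split; lra.
  move=> /andP[x1 x2]; case: (ltP x (a - pi)) => h; [left|right]; apply/andP; split; lra.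
- exact: measurable_funTS.
- apply/disj_setPS => x /=; rewrite !in_itv/= => -[/andP[? ?] /andP[? ?]]; lra.
Qed.

(** Passes from the centred half-open period used for wrapping to the closed interval carrying the
    uniform law. *)
Lemma integral_period (a : R) :
  (\int[mu]_(x in `[(- pi)%R, pi[) w (x + a)%R =
   \int[mu]_(x in `[0%R, (2 * pi)%R]) w x)%E.
Proof.
rewrite integral_period_shift -(integral_period_shift pi).
rewrite -ge0_integral_shift// -integral_itv_bndo_bndc//.
- have e1 : - pi + pi = 0 :> R by ring.
  have e2 : pi + pi = 2 * pi :> R by ring.
  by rewrite e1 e2.
- exact: measurable_funTS.
Qed.

End periodic_integral.

Section unif_circle.
Context {R : realType}.
Local Notation mu := (@lebesgue_measure R).

Lemma to_circle_periodic (x : R) : to_circle (x + 2 * pi) = to_circle x.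
Proof.
by rewrite /to_circle (_ : 2 * pi = pi *+ 2) ?cosD2pi ?sinD2pi// mulr_natl.
Qed.

Lemma dot_to_circle (a x : R) : dot (to_circle a) (to_circle x) = cos (x - a).
Proof. by rewrite /dot /to_circle/= cosB; ring. Qed.

Lemma integral_unifS1 (f : R * R -> \bar R) : measurable_fun setT f ->
  (forall x, (0 <= f x)%E) ->
  (\int[@unifS1 R]_x f x =
   ((2 * pi)^-1)%:E * \int[mu]_(x in `[0%R, (2 * pi)%R]) f (to_circle x))%E.
Proof.
move=> mf f0; rewrite ge0_integral_distribution// integral_uniform//=.
- by rewrite subr0.
- by apply: measurableT_comp => //; exact: measurable_to_circle.
Qed.

Lemma nneseries_EFin_cvg (v : nat -> R) l : series v n @[n --> \oo] --> l ->
  (\sum_(k <oo) (v k)%:E = l%:E)%E.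
Proof.
move=> vl; rewrite -(cvg_lim (@Rhausdorff R) vl) -EFin_lim; last exact: cvgP vl.
by apply/congr_lim/funext => n; rewrite /= sumEFin.
Qed.

(** The indicator of A along [to_circle] is periodic and factors out of the wrapped series, so only
    f gets wrapped. The line is first recentred at a, whence the hypothesis on |x| <= pi alone. *)
Lemma wrapped_density (f h : R -> R) :
  measurable_fun setT f -> (forall x, 0 <= f x) ->
  measurable_fun setT h -> (forall x, 0 <= h x) ->
  (forall x, `|x| <= pi ->
    series (wrap_term f x) n @[n --> \oo] --> (2 * pi)^-1 * h (cos x)) ->
  forall (a : R) (A : set (R * R)), measurable A ->
  (\int[mu]_(x in to_circle @^-1` A) (f (x - a))%:E =
   \int[unifS1]_(x in A) (h (dot (to_circle a) x))%:E)%E.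
Proof.
move=> mf f0 mh h0 fh a A mA.
pose ind (x : measurableTypeR R) : R := \1_A (to_circle x).
have mind : measurable_fun setT ind.
  apply: (measurableT_comp (measurable_indic mA)).
  exact: (@measurable_to_circle R).
have ind0 x : 0 <= ind x by rewrite /ind indicE.
have mindD (b : R) : measurable_fun setT (fun x : measurableTypeR R => ind (x + b)).
  apply: (measurableT_comp mind); exact: measurable_funD.
have ind_periodic x : ind (x + 2 * pi) = ind x by rewrite /ind to_circle_periodic.
have indD x n : ind (x + 2 * pi * n%:R) = ind x.
  by have [] := @periodicDn R (EFin \o ind) (fun x => congr1 EFin (ind_periodic x)) x n.
have indB x n : ind (x - 2 * pi * n%:R) = ind x.
  by have [] := @periodicBn R (EFin \o ind) (fun x => congr1 EFin (ind_periodic x)) x n.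
pose w (x : measurableTypeR R) : \bar R := (ind x * h (cos (x - a)))%:E.
have mw : measurable_fun setT w.
  apply/measurable_EFinP; apply: measurable_funM => //.
  apply: (measurableT_comp mh).
  apply: (measurableT_comp (continuous_measurable_fun (@continuous_cos R))).
  exact: measurable_funD.
have w0 x : (0 <= w x)%E by rewrite lee_fin mulr_ge0.
have w_periodic (x : R) : w (x + 2 * pi) = w x.
  rewrite /w ind_periodic addrAC (_ : 2 * pi = pi *+ 2) ?cosD2pi//.
  by rewrite mulr_natl.
transitivity ((2 * pi)^-1%:E * \int[mu]_(x in `[(- pi)%R, pi[) w (x + a)%R)%E.
  pose g (x : measurableTypeR R) : \bar R := (ind x * f (x - a))%:E.
  have mg : measurable_fun setT g.
    apply/measurable_EFinP; apply: measurable_funM => //.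
    by apply: (measurableT_comp mf); exact: measurable_funD.
  have g0 x : (0 <= g x)%E by rewrite lee_fin mulr_ge0.
  transitivity (\int[mu]_x g x)%E.
    rewrite integral_mkcond; apply: eq_integral => x _.
    rewrite /patch /g /ind indicE (_ : (x \in to_circle @^-1` A) = (to_circle x \in A))//.
    by case: ifPn => _; rewrite ?mul1r ?mul0r.
  rewrite (ge0_integral_affine a (@ltr01 R))// mul1e integral_wrap//; last first.
    exact: (measurableT_comp mg (measurable_affine 1 a)).
  rewrite -ge0_integralZl_EFin//=; last 2 first.
  - apply: measurable_funTS; apply: (measurableT_comp mw).
    exact: measurable_funD.
  - by rewrite invr_ge0 mulr_ge0// pi_ge0.
  apply: eq_integral => x; rewrite inE/= in_itv/= => /andP[x1 x2].
  have xpi : `|x| <= pi by rewrite ler_norml x1 ltW.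
  rewrite /w addrK -EFinM mulrCA.
  rewrite -(nneseries_EFin_cvg (v := fun k => ind (x + a) * wrap_term f x k)).
    apply: eq_eseriesr => -[|k] _; rewrite /ewrap_term /g/= !mul1r ?addrK//.
    rewrite -EFinD; congr EFin.
    by rewrite [RHS]mulrDr ![x + _ + a]addrAC indD indB.
  rewrite (_ : series _ = fun n => ind (x + a) * series (wrap_term f x) n).
    by apply: cvgM; [exact: cvg_cst|exact: fh].
  by apply/funext => n; rewrite /series/= mulr_sumr.
rewrite integral_period// [RHS]integral_mkcond integral_unifS1.
- congr (_ * _)%E; apply: eq_integral => x _.
  rewrite /patch /w /ind indicE dot_to_circle.
  by case: ifPn => _; rewrite ?mul1r ?mul0r.
- apply/(measurable_restrictT _ _).1 => //; apply: measurable_funTS.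
  apply/measurable_EFinP; apply: (measurableT_comp mh).
  exact: measurable_dot.
- by move=> x; apply: erestrict_ge0 => y _; rewrite lee_fin.
Qed.

End unif_circle.

(** * Chebyshev polynomials and their means over the circle *)

Section chebyshev.
Context {R : realType}.
Local Notation mu := (@lebesgue_measure R).
Implicit Types (x y t : R) (n m k : nat).

Lemma chebTS n : @chebT R n.+2 = 2%:P * 'X * chebT n.+1 - chebT n.
Proof. by []. Qed.

Lemma horner_chebT_cos n x : (chebT n).[cos x] = cos (n%:R * x).
Proof.
suff [] : (chebT n).[cos x] = cos (n%:R * x) /\
  (chebT n.+1).[cos x] = cos (n.+1%:R * x) by [].
elim: n => [|n [IH1 IH2]].
  by rewrite hornerC hornerX mul0r cos0 mul1r.
split=> //; rewrite chebTS !hornerE IH1 IH2.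
have -> : n.+2%:R * x = n.+1%:R * x + x by ring.
have -> : n%:R * x = n.+1%:R * x - x by ring.
by rewrite cosB cosD; ring.
Qed.

(** Outside [-1, 1] a Chebyshev polynomial can be below -1. After clamping, [cheb1] takes values in
    [0, 2] on the whole line, and every argument is a cosine. *)
Definition clamp t : R := Num.max (-1) (Num.min 1 t).

Lemma clamp_cos t : clamp t = cos (acos (clamp t)).
Proof.
rewrite acosK// in_itv/= /clamp le_max lexx/= ge_max ge_min lexx/= andbT.
by rewrite (le_trans _ (@ler01 R))// lerN10.
Qed.

Lemma clamp_id t : -1 <= t <= 1 -> clamp t = t.
Proof. by move=> /andP[t1 t2]; rewrite /clamp min_r// max_r. Qed.

Lemma measurable_clamp : measurable_fun setT clamp.
Proof. by apply: measurable_maxr => //; exact: measurable_minr. Qed.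

Definition cheb1 n t : R := 1 + (chebT n).[clamp t].

Lemma cheb1_cos n x : cheb1 n (cos x) = 1 + cos (n%:R * x).
Proof. by rewrite /cheb1 clamp_id ?cos_geN1 ?cos_le1// horner_chebT_cos. Qed.

Lemma cheb1_ge0 n t : 0 <= cheb1 n t.
Proof.
by rewrite /cheb1 clamp_cos horner_chebT_cos -lerBlDl sub0r cos_geN1.
Qed.

Lemma cheb1_le2 n t : cheb1 n t <= 2.
Proof.
rewrite /cheb1 clamp_cos horner_chebT_cos.
by have := cos_le1 (n%:R * acos (clamp t)); lra.
Qed.

Lemma measurable_horner (p : {poly R}) : measurable_fun setT (horner p).
Proof. by apply: continuous_measurable_fun; exact: continuous_horner. Qed.

Lemma measurable_cheb1 n : measurable_fun setT (cheb1 n).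
Proof.
apply: measurable_funD => //.
exact: (measurableT_comp (measurable_horner _) measurable_clamp).
Qed.

Definition angle_mean (f : measurableTypeR R -> R) : \bar R :=
  ((2 * pi)^-1%:E * \int[mu]_(x in `[0%R, (2 * pi)%R]) (f x)%:E)%E.

Lemma angle_meanD (f g : measurableTypeR R -> R) : measurable_fun setT f -> measurable_fun setT g ->
  (forall x, 0 <= f x) -> (forall x, 0 <= g x) ->
  angle_mean (fun x => f x + g x) = (angle_mean f + angle_mean g)%E.
Proof.
move=> mf mg f0 g0; rewrite /angle_mean.
under eq_integral do rewrite EFinD.
rewrite ge0_integralD//=; last 4 first.
- by move=> x _; rewrite lee_fin.
- by apply/measurable_EFinP; exact: measurable_funTS.
- by move=> x _; rewrite lee_fin.
- by apply/measurable_EFinP; exact: measurable_funTS.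
by rewrite ge0_muleDr//; apply: integral_ge0 => x _; rewrite lee_fin.
Qed.

Lemma angle_meanZ (k : R) (f : measurableTypeR R -> R) : measurable_fun setT f -> (forall x, 0 <= f x) ->
  0 <= k -> angle_mean (fun x => k * f x) = (k%:E * angle_mean f)%E.
Proof.
move=> mf f0 k0; rewrite /angle_mean.
under eq_integral do rewrite EFinM.
rewrite ge0_integralZl_EFin//=; first by rewrite muleCA.
- by move=> x _; rewrite lee_fin.
- by apply/measurable_EFinP; exact: measurable_funTS.
Qed.

Lemma angle_mean_cst (k : R) : angle_mean (fun=> k) = k%:E.
Proof.
rewrite /angle_mean integral_cst//= lebesgue_measure_itv/= lte_fin.
rewrite mulr_gt0 ?pi_gt0// sube0 -!EFinM; congr EFin.
by rewrite mulrC mulfK// gt_eqF// mulr_gt0// pi_gt0.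
Qed.

Let mcosM k : measurable_fun setT (fun x : measurableTypeR R => cos (k%:R * x)).
Proof.
apply: (measurableT_comp (continuous_measurable_fun (@continuous_cos R))).
exact: measurable_funM.
Qed.

Let mcos1 k : measurable_fun setT (fun x : measurableTypeR R => 1 + cos (k%:R * x)).
Proof. by apply: measurable_funD => //; exact: mcosM. Qed.

Let cos1_ge0 k x : 0 <= 1 + cos (k%:R * x).
Proof. by rewrite -lerBlDl sub0r cos_geN1. Qed.

(* Shifting by a half period of the cosine changes its sign. *)
Lemma angle_mean_cos1 k : (0 < k)%N ->
  angle_mean (fun x => 1 + cos (k%:R * x)) = 1%E.
Proof.
move=> k0; pose w (x : measurableTypeR R) := (1 + cos (k%:R * x))%:E.
have kR : k%:R != 0 :> R by rewrite pnatr_eq0 -lt0n.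
have mw : measurable_fun setT w by apply/measurable_EFinP; exact: mcos1.
have w0 x : (0 <= w x)%E by rewrite lee_fin.
have wp (x : R) : w (x + 2 * pi) = w x.
  rewrite /w mulrDr (_ : k%:R * (2 * pi) = 2 * pi * k%:R) ?cos_periodn//; ring.
have e1 := integral_period wp mw w0 0.
have e2 := integral_period wp mw w0 (pi / k%:R).
have : (\int[mu]_(x in `[0%R, (2 * pi)%R]) w x +
    \int[mu]_(x in `[0%R, (2 * pi)%R]) w x = (4 * pi)%:E)%E.
  rewrite -{1}e1 -e2 -ge0_integralD//=; last 2 first.
  - apply: measurable_funTS; apply: (measurableT_comp mw); exact: measurable_funD.
  - apply: measurable_funTS; apply: (measurableT_comp mw); exact: measurable_funD.
  transitivity (\int[mu]_(x in `[(- pi)%R, pi[) (cst (2%:E : \bar R)) x)%E.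
    apply: eq_integral => x _; rewrite /w addr0 -EFinD; congr EFin.
    rewrite mulrDr [k%:R * (_ / _)]mulrC divfK// cosDpi; ring.
  rewrite integral_cst//= lebesgue_measure_itv/= lte_fin.
  rewrite gtrN ?pi_gt0// -EFinB -EFinM; congr EFin; ring.
rewrite /angle_mean -/(w _); case: (\int[mu]_(x in _) w x)%E => // r.
rewrite -EFinD => -[rr]; rewrite -EFinM; congr EFin.
have -> : r = 2 * pi by lra.
by rewrite mulVf// gt_eqF// mulr_gt0// pi_gt0.
Qed.

Lemma angle_mean_cos1_0 : angle_mean (fun x => 1 + cos (0%:R * x)) = 2%:E.
Proof.
rewrite -[RHS]angle_mean_cst; congr angle_mean; apply/funext => x.
by rewrite mul0r cos0; ring.
Qed.

Lemma angle_mean_cos1M m n : (0 < m)%N -> (0 < n)%N ->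
  angle_mean (fun x => (1 + cos (m%:R * x)) * (1 + cos (n%:R * x))) =
  (1 + (m == n)%:R / 2)%:E.
Proof.
move=> m0 n0; wlog mn : m n m0 n0 / (m <= n)%N => [hw|].
  have [/hw->//|/ltnW/hw h] := leqP m n.
  by rewrite eq_sym -h//; congr angle_mean; apply/funext => x; rewrite mulrC.
have mM : measurable_fun setT (fun x : measurableTypeR R =>
    (1 + cos (m%:R * x)) * (1 + cos (n%:R * x))).
  by apply: measurable_funM; exact: mcos1.
have M0 x : 0 <= (1 + cos (m%:R * x)) * (1 + cos (n%:R * x)) by rewrite mulr_ge0.
have mh k : measurable_fun setT (fun x : measurableTypeR R => 2^-1 * (1 + cos (k%:R * x))).
  by apply: measurable_funM => //; exact: mcos1.
have h0 k x : 0 <= 2^-1 * (1 + cos (k%:R * x)) by rewrite mulr_ge0.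
(* The product formula for cosines, with the constant 2 added on the left so that both sides are
   sums of nonnegative functions. When m = n the difference frequency is 0, whose mean is 2 instead
   of 1. *)
have : angle_mean (fun x => (1 + cos (m%:R * x)) * (1 + cos (n%:R * x)) + 2%R) =
   angle_mean (fun x => ((1 + cos (m%:R * x)) + (1 + cos (n%:R * x))) +
     (2^-1 * (1 + cos ((m + n)%:R * x)) + 2^-1 * (1 + cos ((n - m)%:R * x)))).
  congr angle_mean; apply/funext => x.
  rewrite natrD natrB//.
  have -> : (m%:R + n%:R) * x = n%:R * x + m%:R * x by ring.
  by rewrite mulrBl cosB cosD; field.
rewrite angle_meanD// angle_mean_cst.
rewrite angle_meanD; last 4 first.
- by apply: measurable_funD; exact: mcos1.
- by apply: measurable_funD; exact: mh.
- by move=> x; rewrite addr_ge0.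
- by move=> x; rewrite addr_ge0.
have half0 : 0 <= 2^-1 :> R by rewrite invr_ge0.
rewrite (angle_meanD (mcos1 m) (mcos1 n) (cos1_ge0 m) (cos1_ge0 n)).
rewrite (angle_meanD (mh (m + n)%N) (mh (n - m)%N) (h0 _) (h0 _)).
rewrite !(fun k => angle_meanZ (mcos1 k) (cos1_ge0 k) half0).
have -> : angle_mean (fun x => 1 + cos ((n - m)%:R * x)) = (1 + (m == n)%:R)%:E.
  have [->|nm] := eqVneq m n; first by rewrite subnn angle_mean_cos1_0.
  by rewrite addr0 angle_mean_cos1// subn_gt0 ltn_neqAle nm.
rewrite !angle_mean_cos1 ?addn_gt0 ?m0//.
case: angle_mean => // r; rewrite -!EFinM -!EFinD => -[rE].
by congr EFin; lra.
Qed.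

Lemma angle_mean_cos_sqr n : (0 < n)%N ->
  angle_mean (fun x => cos (n%:R * x) * cos (n%:R * x)) = (2^-1)%:E.
Proof.
move=> n0; rewrite -[RHS]mule1 -(@angle_mean_cos1 (n + n)) ?addn_gt0 ?n0//.
rewrite -angle_meanZ//; congr angle_mean; apply/funext => x.
by rewrite natrD mulrDl cosD -!expr2 sin2cos2; field.
Qed.

Lemma integral_nu1 (f : R -> R) : measurable_fun setT f -> (forall x, 0 <= f x) ->
  (\int[@nu1 R]_x (f x)%:E = angle_mean (f \o cos))%E.
Proof.
move=> mf f0; have mEf : measurable_fun setT (EFin \o f) by apply/measurable_EFinP.
rewrite ge0_integral_distribution//.
rewrite integral_unifS1//=.
- congr (_ * _)%E; apply: eq_integral => x _.
  by rewrite /dot/= mul1r mul0r addr0.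
- by apply: (measurableT_comp mEf); exact: measurable_dot.
- by move=> x; rewrite lee_fin.
Qed.

End chebyshev.

(** * Laws with a given cosine series *)

Section cosine_profile.
Context {R : realType}.
Local Notation mu := (@lebesgue_measure R).
Variable c : nat -> R.
Hypotheses (c0 : c 0 = 1) (c_ge0 : forall n, 0 <= c n)
  (cvg_c : cvgn (series (fun n => c n.+1))).

Definition cheb_series (t : R) : R :=
  limn (series (fun n => 2 * c n.+1 * cheb1 n.+1 t)).

Definition total_coef : R := limn (series (fun n => 2 * c n.+1)).

Local Notation G := cheb_series.
Local Notation b := total_coef.

Lemma cvg_total_coef : series (fun n => 2 * c n.+1) n @[n --> \oo] --> b.
Proof. exact: (is_cvg_seriesZ (k := 2 : R) cvg_c). Qed.

Lemma cvg_cheb_series t :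
  series (fun n => 2 * c n.+1 * cheb1 n.+1 t) n @[n --> \oo] --> G t.
Proof.
apply: (@series_le_cvg _ _ (fun n => 2 * (2 * c n.+1))).
- by move=> n; rewrite !mulr_ge0// cheb1_ge0.
- by move=> n; rewrite !mulr_ge0.
- by move=> n; rewrite mulrC ler_wpM2r ?mulr_ge0// cheb1_le2.
- exact: (is_cvg_seriesZ (k := 2 : R) (cvgP _ cvg_total_coef)).
Qed.

Lemma nneseries_total_coef : (\sum_(n <oo) (2 * c n.+1)%:E = b%:E)%E.
Proof. exact: nneseries_EFin_cvg cvg_total_coef. Qed.

Lemma nneseries_cheb t : (\sum_(n <oo) (2 * c n.+1 * cheb1 n.+1 t)%:E = (G t)%:E)%E.
Proof. exact: nneseries_EFin_cvg (@cvg_cheb_series t). Qed.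

Lemma total_coef_ge0 : 0 <= b.
Proof.
rewrite -lee_fin -nneseries_total_coef nneseries_ge0// => n _ _.
by rewrite lee_fin mulr_ge0.
Qed.

Lemma cheb_series_ge0 t : 0 <= G t.
Proof.
rewrite -lee_fin -nneseries_cheb nneseries_ge0// => n _ _.
by rewrite lee_fin !mulr_ge0// cheb1_ge0.
Qed.

Lemma measurable_cheb_series : measurable_fun setT G.
Proof.
apply/measurable_EFinP.
rewrite (_ : _ \o _ = fun t => \sum_(n <oo) (2 * c n.+1 * cheb1 n.+1 t)%:E)%E.
  apply: ge0_emeasurable_sum => [n t _ _|n _].
    by rewrite lee_fin !mulr_ge0// cheb1_ge0.
  by apply/measurable_EFinP; apply: measurable_funM => //; exact: measurable_cheb1.
by apply/funext => t; rewrite nneseries_cheb.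
Qed.

(** The maximum makes nonnegativity unconditional; [profileE] removes it on [-1, 1] once the cosine
    series is known to be nonnegative. *)
Definition profile (t : R) : R := Num.max 0 (1 - b + G t).

Lemma profile_ge0 t : 0 <= profile t. Proof. by rewrite le_max lexx. Qed.

Lemma measurable_profile : measurable_fun setT profile.
Proof.
apply: measurable_maxr => //; apply: measurable_funD => //.
exact: measurable_cheb_series.
Qed.

(** Writing [cos (n x)] as [(1 + cos (n x)) - 1] trades a series of varying signs for two convergent
    series of nonnegative terms. *)
Lemma cvg_cos_series x :
  series (cos_term c x) n @[n --> \oo] --> 1 - b + G (cos x).
Proof.
rewrite -cvg_shiftS.
rewrite (_ : (fun n => _) = fun n => 1 - series (fun n => 2 * c n.+1) n +
    series (fun n => 2 * c n.+1 * cheb1 n.+1 (cos x)) n).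
  apply: cvgD; last exact: cvg_cheb_series.
  by apply: cvgB; [exact: cvg_cst|exact: cvg_total_coef].
apply/funext => n /=; rewrite /series/= big_nat_recl//=.
rewrite {1}/cos_term c0 mul0r cos0 !mulr1 -addrA; congr (_ + _).
rewrite addrC -sumrB; apply: eq_bigr => k _.
by rewrite cheb1_cos /cos_term; ring.
Qed.

(** This does not follow from [c_ge0]: for the Cauchy laws it is the positivity of the Poisson
    kernel, for the normal laws that of the wrapped density. *)
Hypothesis cos_series_ge0 : forall x, `|x| <= pi -> 0 <= 1 - b + G (cos x).

Lemma profileE t : -1 <= t <= 1 -> profile t = 1 - b + G t.
Proof.
move=> t1; rewrite /profile max_r// -(acosK (x := t)) ?in_itv//.
by apply: cos_series_ge0; rewrite ger0_norm ?acos_ge0// acos_lepi.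
Qed.

Lemma profile_cos x : profile (cos x) = limn (series (cos_term c x)).
Proof.
rewrite profileE ?cos_geN1 ?cos_le1//.
by apply/esym/cvg_lim => //; exact: cvg_cos_series.
Qed.

Let mcos : measurable_fun setT (@cos R : measurableTypeR R -> R).
Proof. exact: (continuous_measurable_fun (@continuous_cos R)). Qed.

Let mcst (k : R) : measurable_fun setT (fun _ : measurableTypeR R => k).
Proof. exact: measurable_cst. Qed.

Let mprof : measurable_fun setT (profile \o cos : measurableTypeR R -> R).
Proof. exact: (measurableT_comp measurable_profile mcos). Qed.

Let mG : measurable_fun setT (G \o cos : measurableTypeR R -> R).
Proof. exact: (measurableT_comp measurable_cheb_series mcos). Qed.

Let mu1 n : measurable_fun setT (cheb1 n \o cos : measurableTypeR R -> R).
Proof. exact: (measurableT_comp (measurable_cheb1 n) mcos). Qed.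

Lemma integral_nu1_cheb1 n : (0 < n)%N -> (\int[@nu1 R]_t (cheb1 n t)%:E = 1%E)%E.
Proof.
move=> n0; rewrite integral_nu1.
- rewrite -[RHS](angle_mean_cos1 n0); congr angle_mean.
  by apply/funext => x /=; rewrite cheb1_cos.
- exact: measurable_cheb1.
- exact: cheb1_ge0.
Qed.

Lemma integral_nu1_cheb1M m n : (0 < m)%N -> (0 < n)%N ->
  (\int[@nu1 R]_t (cheb1 m t * cheb1 n t)%:E = (1 + (m == n)%:R / 2)%:E)%E.
Proof.
move=> m0 n0; rewrite integral_nu1.
- rewrite -[RHS](angle_mean_cos1M m0 n0); congr angle_mean.
  by apply/funext => x /=; rewrite !cheb1_cos.
- by apply: measurable_funM; exact: measurable_cheb1.
- by move=> x; rewrite mulr_ge0 ?cheb1_ge0.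
Qed.

Lemma integral_nu1_cheb_series : (\int[@nu1 R]_t (G t)%:E = b%:E)%E.
Proof.
under eq_integral do rewrite -nneseries_cheb.
rewrite integral_nneseries//.
- rewrite -nneseries_total_coef; apply: eq_eseriesr => n _.
  under eq_integral do rewrite EFinM.
  rewrite ge0_integralZl_EFin//=.
  + by rewrite integral_nu1_cheb1// mule1.
  + by move=> t _; rewrite lee_fin cheb1_ge0.
  + by apply/measurable_EFinP; exact: measurable_cheb1.
  + by rewrite mulr_ge0.
- move=> n; apply/measurable_EFinP; apply: measurable_funM => //.
  exact: measurable_cheb1.
- by move=> n t _; rewrite lee_fin !mulr_ge0// cheb1_ge0.
Qed.

(** Against [cheb1 n] every term contributes its full weight 2 c k, and the term k = n an extra half
    of it. *)
Lemma integral_nu1_cheb_seriesM n : (0 < n)%N ->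
  (\int[@nu1 R]_t (G t * cheb1 n t)%:E = (b + c n)%:E)%E.
Proof.
case: n => // n _.
transitivity (\int[@nu1 R]_t \sum_(k <oo) (2 * c k.+1 * (cheb1 k.+1 t * cheb1 n.+1 t))%:E)%E.
  apply: eq_integral => t _; rewrite mulrC EFinM -nneseries_cheb -nneseriesZl.
    by apply: eq_eseriesr => k _; rewrite -EFinM; congr EFin; ring.
  by move=> k _; rewrite lee_fin !mulr_ge0// cheb1_ge0.
rewrite integral_nneseries//; last 2 first.
- move=> k; apply/measurable_EFinP; apply: measurable_funM => //.
  by apply: measurable_funM; exact: measurable_cheb1.
- by move=> k t _; rewrite lee_fin !mulr_ge0// cheb1_ge0.
transitivity (\sum_(k <oo) ((2 * c k.+1)%:E + (c k.+1 * (k == n)%:R)%:E))%E.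
  apply: eq_eseriesr => k _.
  under eq_integral do rewrite EFinM.
  rewrite ge0_integralZl_EFin//=.
  + by rewrite integral_nu1_cheb1M// eqSS -EFinM -EFinD; congr EFin; field.
  + by move=> t _; rewrite lee_fin mulr_ge0 ?cheb1_ge0.
  + apply/measurable_EFinP.
    by apply: measurable_funM; exact: measurable_cheb1.
  + by rewrite mulr_ge0.
rewrite nneseriesD.
- rewrite nneseries_total_coef EFinD; congr (_ + _)%E.
  rewrite (nneseriesD1 (n := n))//; last by move=> k _; rewrite lee_fin mulr_ge0.
  rewrite eqxx mulr1 eseries0 ?adde0// => k _ /= /negPf ->.
  by rewrite mulr0.
- by move=> k _ _; rewrite lee_fin mulr_ge0.
- by move=> k _ _; rewrite lee_fin mulr_ge0.
Qed.

Lemma integral_nu1_profile : (\int[@nu1 R]_t (profile t)%:E = 1%E)%E.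
Proof.
have eP := integral_nu1 measurable_profile profile_ge0.
have := integral_nu1 measurable_cheb_series cheb_series_ge0.
rewrite integral_nu1_cheb_series => eG.
(* The negative term is carried to the other side, and the equation is solved after all values are
   known to be finite. *)
have : angle_mean (fun x => (profile \o cos) x + b) = angle_mean (fun x => 1 + (G \o cos) x).
  congr angle_mean; apply/funext => x /=.
  by rewrite profileE ?cos_geN1 ?cos_le1//; ring.
have b0 := total_coef_ge0.
rewrite (angle_meanD mprof (mcst b) (fun x => profile_ge0 (cos x)) (fun=> b0)).
rewrite (angle_meanD (mcst 1) mG (fun=> @ler01 R) (fun x => cheb_series_ge0 (cos x))).
rewrite -eP -eG !angle_mean_cst; case: integral => // r.
by rewrite -!EFinD => -[rE]; congr EFin; lra.
Qed.

Lemma integral_nu1_profileM n : (0 < n)%N ->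
  (\int[@nu1 R]_t (profile t * cheb1 n t)%:E = (1 + c n)%:E)%E.
Proof.
move=> n0; have b0 := total_coef_ge0.
have PU0 t : 0 <= profile t * cheb1 n t by rewrite mulr_ge0 ?profile_ge0 ?cheb1_ge0.
have GU0 t : 0 <= G t * cheb1 n t by rewrite mulr_ge0 ?cheb_series_ge0 ?cheb1_ge0.
have U0 (t : R) : 0 <= cheb1 n t := cheb1_ge0 n t.
have mPU := measurable_funM measurable_profile (measurable_cheb1 n).
have mGU := measurable_funM measurable_cheb_series (measurable_cheb1 n).
have eP := integral_nu1 mPU PU0.
have := integral_nu1 mGU GU0.
rewrite integral_nu1_cheb_seriesM// => eG.
have := integral_nu1 (measurable_cheb1 n) U0.
rewrite integral_nu1_cheb1// => eU.
have : angle_mean (fun x => profile (cos x) * cheb1 n (cos x) + b * cheb1 n (cos x)) =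
    angle_mean (fun x => cheb1 n (cos x) + G (cos x) * cheb1 n (cos x)).
  congr angle_mean; apply/funext => x /=.
  by rewrite profileE ?cos_geN1 ?cos_le1//; ring.
have mbU : measurable_fun setT (fun x : measurableTypeR R => b * (cheb1 n \o cos) x).
  by apply: measurable_funM => //; exact: mu1.
have bU0 (x : R) : 0 <= b * cheb1 n (cos x) by rewrite mulr_ge0.
rewrite (angle_meanD (measurableT_comp mPU mcos) mbU (fun x => PU0 (cos x)) bU0).
rewrite (angle_meanD (mu1 n) (measurableT_comp mGU mcos) (fun x => U0 (cos x))
  (fun x => GU0 (cos x))).
rewrite (angle_meanZ (mu1 n) (fun x => U0 (cos x)) b0).
rewrite -eP -eG -eU.
case: integral => // r.
by rewrite -!EFinM -!EFinD => -[rE]; congr EFin; lra.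
Qed.

Lemma ae_nu1 : {ae @nu1 R, forall t, -1 <= t <= 1}.
Proof.
exists (~` [set t | -1 <= t <= 1]); split => //.
  apply: measurableC.
  rewrite (_ : [set _ | _] = `[-1, 1]%classic); first exact: measurable_itv.
  by apply/seteqP; split => x; rewrite /= in_itv.
rewrite /nu1 /distribution /pushforward /= /distribution /pushforward.
rewrite (_ : _ @^-1` _ = set0) ?measure0//.
apply/seteqP; split => // y; rewrite /= /dot/= mul1r mul0r addr0 => h.
by apply: h; rewrite cos_geN1 cos_le1.
Qed.

Lemma integrable_nu1 (f : R -> R) : measurable_fun setT f -> (forall t, 0 <= f t) ->
  (\int[@nu1 R]_t (f t)%:E < +oo)%E -> (@nu1 R).-integrable setT (EFin \o f).
Proof.
move=> mf f0 foo; apply/integrableP; split; first exact/measurable_EFinP.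
by under eq_integral do rewrite gee0_abs ?lee_fin//.
Qed.

(** Equal integrals over all measurable sets give equality almost everywhere. Then
    [T_n = cheb1 n - 1] on [-1, 1] yields (1 + c n) - 1 for the inner product, and the squared norm
    of T_n is 1 / 2. *)
Lemma beta_coef_profile (g : R -> R) n : (0 < n)%N ->
  measurable_fun setT g -> (forall t, 0 <= g t) ->
  (forall E : set R, measurable E ->
    \int[@nu1 R]_(t in E) (g t)%:E = \int[@nu1 R]_(t in E) (profile t)%:E)%E ->
  beta_coef g n = 2 * c n.
Proof.
move=> n0 mg g0 gE.
have iP : (@nu1 R).-integrable setT (EFin \o profile).
  apply: integrable_nu1 => //; first exact: measurable_profile.
  - exact: profile_ge0.
  - by rewrite integral_nu1_profile ltry.
have aeg : ae_eq (@nu1 R) setT (EFin \o profile) (EFin \o g).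
  apply: integral_ae_eq => //; first exact/measurable_EFinP.
  by move=> E _ mE; rewrite gE.
have mPU := measurable_funM measurable_profile (measurable_cheb1 n).
have iPU : (@nu1 R).-integrable setT (EFin \o (fun t => profile t * cheb1 n t)).
  apply: integrable_nu1 => //.
  - by move=> t; rewrite mulr_ge0 ?profile_ge0 ?cheb1_ge0.
  - by rewrite integral_nu1_profileM// ltry.
have mT : measurable_fun setT (horner (@chebT R n)) by exact: measurable_horner.
have num : inner0 g (horner (chebT n)) = c n.
  rewrite /inner0 /Rintegral.
  rewrite (@ae_eq_integral _ _ _ (@nu1 R) setT
    (fun t => (profile t * cheb1 n t)%:E - (profile t)%:E)%E)//.
  - rewrite integralB_EFin// integral_nu1_profile integral_nu1_profileM//=.
    by ring.
  - by apply/measurable_EFinP; exact: measurable_funM.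
  - apply: emeasurable_funB; apply/measurable_EFinP => //.
    exact: measurable_profile.
  - move: aeg ae_nu1; apply: filterS2 => t /= gt t1 _.
    have [<-//] := gt I.
    by rewrite -EFinB; congr EFin; rewrite /cheb1 clamp_id//; ring.
have den : inner0 (horner (chebT n)) (horner (chebT n)) = 2^-1 :> R.
  rewrite /inner0 /Rintegral integral_nu1.
  - rewrite (_ : _ \o _ = fun x => cos (n%:R * x) * cos (n%:R * x)).
      by rewrite angle_mean_cos_sqr.
    by apply/funext => x /=; rewrite horner_chebT_cos.
  - exact: measurable_funM.
  - by move=> t; rewrite -expr2 sqr_ge0.
by rewrite /beta_coef num den; field.
Qed.

End cosine_profile.

(** * From the profile to the law on the circle *)

Section circle_laws.
Context {R : realType}.
Implicit Types (c : nat -> R) (A : set (R * R)).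

(** Integrands on the plane need to be compared on angles only. The exceptional set is given by
    [dot x x != 1] so as to be measurable, whatever Q is. *)
Lemma ae_unifS1 (Q : set (R * R)) : (forall y, Q (to_circle y)) ->
  {ae @unifS1 R, forall x, Q x}.
Proof.
move=> Qc; exists [set x : R * R | dot x x != 1]; split.
- have mdot : measurable_fun setT (fun x : R * R => dot x x).
    by apply: measurable_funD; apply: measurable_funM.
  rewrite (_ : [set _ | _] = (fun x : R * R => dot x x) @^-1` (~` [set 1])).
    rewrite -[X in measurable X]setTI; apply: mdot => //.
    by apply: measurableC; exact: measurable_set1.
  by apply/seteqP; split => x /= /eqP.
- rewrite /unifS1 /= /distribution /pushforward (_ : _ @^-1` _ = set0) ?measure0//.
  apply/seteqP; split => // y /=.
  by rewrite dot_to_circle subrr cos0 eqxx.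
- move=> x /= nQ; apply/eqP => x1; apply: nQ.
  have /S1P[y ->] : S1 x by rewrite /S1/= x1 sqrtr1.
  exact: Qc.
Qed.

Lemma ae_eq_integral_circle (f g : R * R -> \bar R) A : measurable A ->
  measurable_fun setT f -> measurable_fun setT g ->
  (forall y, f (to_circle y) = g (to_circle y)) ->
  (\int[@unifS1 R]_(x in A) f x = \int[@unifS1 R]_(x in A) g x)%E.
Proof.
move=> mA mf mg fg; apply: ae_eq_integral => //.
- exact: measurable_funTS.
- exact: measurable_funTS.
have := @ae_unifS1 (fun x => f x = g x) fg; apply: filterS => x /= -> _ //.
Qed.

Lemma to_circle0 : to_circle 0 = (1, 0) :> R * R.
Proof. by rewrite /to_circle cos0 sin0. Qed.

Lemma Delta0_cheb1 n a A : measurable A ->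
  Delta0 n (to_circle a) A =
  (\int[@unifS1 R]_(x in A) (cheb1 n (dot (to_circle a) x))%:E)%E.
Proof.
move=> mA; apply: ae_eq_integral_circle => //.
- apply/measurable_EFinP; apply: measurable_funD => //.
  exact: (measurableT_comp (measurable_horner _) (measurable_dot _)).
- apply/measurable_EFinP.
  exact: (measurableT_comp (measurable_cheb1 n) (measurable_dot _)).
- by move=> y; rewrite dot_to_circle cheb1_cos horner_chebT_cos.
Qed.

Section profile_law.
Variables (c : nat -> R) (P : R -> set (R * R) -> \bar R).
Hypotheses (c0 : c 0 = 1) (c_ge0 : forall n, 0 <= c n)
  (cvg_c : cvgn (series (fun n => c n.+1)))
  (cos_series_ge0 : forall x, `|x| <= pi ->
     0 <= 1 - total_coef c + cheb_series c (cos x))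
  (PE : forall a A, measurable A ->
     (P a A = \int[unifS1]_(x in A) (profile c (dot (to_circle a) x))%:E)%E).

Local Notation G := (cheb_series c).
Local Notation b := (total_coef c).

Lemma has_profile_profile : has_profile P (profile c).
Proof.
split; [exact: measurable_profile|exact: profile_ge0|].
by move=> eta a A _ -> mA; rewrite PE.
Qed.

Lemma beta_coef_has_profile g n : has_profile P g -> (0 < n)%N ->
  beta_coef g n = 2 * c n.
Proof.
move=> [mg g0 Pg] n0; apply: beta_coef_profile => // E mE.
(* The two profiles are compared at the angle 0, on preimages of E under the map defining [nu1]. *)
have mEd : measurable (dot (1, 0) @^-1` E : set (R * R)).
  by rewrite -[X in measurable X]setTI; apply: measurable_dot.
have S10 : S1 ((1, 0) : R * R) by apply/S1P; exists 0; rewrite to_circle0.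
have := Pg _ 0 _ S10 (esym to_circle0) mEd; rewrite PE// to_circle0 => e.
rewrite !(@ge0_integral_pushforward _ _ _ _ _ _ (measurable_dot (1, 0)) unifS1)//.
- by apply: measurable_funTS; apply/measurable_EFinP; exact: measurable_profile.
- by move=> t _; rewrite lee_fin profile_ge0.
- by apply: measurable_funTS; apply/measurable_EFinP.
- by move=> t _; rewrite lee_fin.
Qed.

Lemma beta_has_profile g : has_profile P g -> beta g = b%:E.
Proof.
move=> Pg; rewrite /beta -nneseries_total_coef// -(nneseries_addn 1).
  apply: eq_eseriesr => n _.
  by rewrite addn1 (beta_coef_has_profile Pg)// ger0_norm// mulr_ge0.
by move=> n; rewrite lee_fin.
Qed.

Lemma cheb_series_le t : G t <= 2 * b.
Proof.
have cb2 : series (fun n => 2 * (2 * c n.+1)) n @[n --> \oo] --> 2 * b.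
  rewrite (_ : series _ = fun n => 2 * series (fun n => 2 * c n.+1) n).
    by apply: cvgM; [exact: cvg_cst|exact: cvg_total_coef].
  by apply/funext => n; rewrite /series/= mulr_sumr.
rewrite -(cvg_lim (@Rhausdorff R) cb2); apply: lim_series_le.
- by apply: cvgP; exact: cvg_cheb_series.
- exact: cvgP cb2.
- by move=> n; rewrite mulrC ler_wpM2r ?mulr_ge0// cheb1_le2.
Qed.

(** The weights enter only through [b * w n = 2 * c n], which also covers b = 0, the uniform member
    of the Cauchy family. The subtraction of b is delayed to the last line, where all terms are
    finite because G <= 2 b. *)
Lemma mixture_profile w a A : (forall n, 0 <= w n) ->
  (forall n, (0 < n)%N -> b * w n = 2 * c n) -> measurable A ->
  P a A = mixture b%:E w (to_circle a) A.
Proof.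
move=> w0 bw mA; rewrite PE// /mixture.
set eta := to_circle a; have b0 : 0 <= b by exact: total_coef_ge0.
have mdot (f : R -> R) : measurable_fun setT f ->
    measurable_fun setT (fun x : R * R => (f (dot eta x))%:E).
  by move=> mf; apply/measurable_EFinP; exact: (measurableT_comp mf (measurable_dot eta)).
have mG : measurable_fun setT G by exact: measurable_cheb_series.
have mP : measurable_fun setT (profile c) by exact: measurable_profile.
have G0 t : 0 <= G t by exact: cheb_series_ge0.
have D0 n : (0 <= Delta0 n eta A)%E.
  rewrite Delta0_cheb1//; apply: integral_ge0 => x _.
  by rewrite lee_fin cheb1_ge0.
have sumE : (b%:E * \sum_(1 <= n <oo) ((w n)%:E * Delta0 n eta A) =
    \int[unifS1]_(x in A) (G (dot eta x))%:E)%E.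
  under eq_integral do rewrite -nneseries_cheb//.
  rewrite integral_nneseries//; last 2 first.
  - move=> n; apply: measurable_funTS.
    apply: (mdot (fun t => 2 * c n.+1 * cheb1 n.+1 t)).
    by apply: measurable_funM => //; exact: measurable_cheb1.
  - by move=> n x _; rewrite lee_fin !mulr_ge0// cheb1_ge0.
  rewrite -(nneseries_addn 1); last first.
    by move=> n; rewrite mule_ge0 ?D0// lee_fin w0.
  rewrite -nneseriesZl; last first.
    by move=> n _; rewrite mule_ge0 ?D0// lee_fin w0.
  apply: eq_eseriesr => n _; rewrite addn1 muleA -EFinM bw// Delta0_cheb1//.
  rewrite -ge0_integralZl_EFin//=.
  - by move=> x _; rewrite lee_fin cheb1_ge0.
  - by apply: measurable_funTS; apply: mdot; exact: measurable_cheb1.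
  - by rewrite mulr_ge0.
have key : (\int[unifS1]_(x in A) (profile c (dot eta x))%:E + b%:E * unifS1 A =
    unifS1 A + \int[unifS1]_(x in A) (G (dot eta x))%:E)%E.
  rewrite -(integral_cst unifS1 mA b%:E) -[in RHS](mul1e (unifS1 A)).
  rewrite -(integral_cst unifS1 mA 1%E) -!ge0_integralD//=.
  - apply: ae_eq_integral_circle => //.
    + by apply: emeasurable_funD => //; exact: mdot.
    + by apply: emeasurable_funD => //; exact: mdot.
    + move=> y; rewrite dot_to_circle -!EFinD profileE ?cos_geN1 ?cos_le1//.
      by congr EFin; ring.
  - by move=> x _; rewrite lee_fin.
  - by apply: measurable_funTS; exact: mdot.
  - by move=> x _; rewrite lee_fin profile_ge0.
  - by apply: measurable_funTS; exact: mdot.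
have Ufin : unifS1 A \is a fin_num by exact: fin_num_measure.
have Gfin : (\int[unifS1]_(x in A) (G (dot eta x))%:E)%E \is a fin_num.
  rewrite ge0_fin_numE; last by apply: integral_ge0 => x _; rewrite lee_fin.
  apply: (@le_lt_trans _ _ (\int[unifS1]_(x in A) (2 * b)%:E)%E).
    apply: ge0_le_integral => //.
    - by move=> x _; rewrite lee_fin.
    - by apply: measurable_funTS; exact: mdot.
    - by move=> x _; rewrite lee_fin cheb_series_le.
  by rewrite integral_cst// lte_mul_pinfty ?lee_fin ?mulr_ge0// ltey_eq Ufin.
rewrite sumE; move: key Gfin Ufin.
case: (\int[_]_(x in A) (G _)%:E)%E => // s; case: (unifS1 A) => // u.
case: (\int[_]_(x in A) (profile c _)%:E)%E => // p.
move=> + _ _; rewrite -EFinB -!EFinM -!EFinD => -[e]; congr EFin; lra.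
Qed.

End profile_law.
End circle_laws.

(** * The wrapped Cauchy and normal laws *)

Section wrapped_laws.
Context {R : realType}.
Local Notation mu := (@lebesgue_measure R).
Implicit Types (rho s a x y : R) (A : set (R * R)).

Lemma wrap_termZ (k : R) (f : R -> R) x :
  wrap_term (fun y => k * f y) x = fun n => k * wrap_term f x n.
Proof. by apply/funext => -[|n] //=; rewrite [RHS]mulrDr. Qed.

Lemma cvg_series_scale (k l : R) (u : nat -> R) :
  series u n @[n --> \oo] --> l ->
  series (fun n => k * u n) n @[n --> \oo] --> k * l.
Proof.
move=> ul; rewrite (_ : series _ = fun n => k * series u n).
  by apply: cvgM; [exact: cvg_cst|].
by apply/funext => n; rewrite /series/= mulr_sumr.
Qed.

Definition cauchy_coef rho (n : nat) : R := rho ^+ n.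

Lemma cauchy_coef_ge0 rho n : 0 <= rho -> 0 <= cauchy_coef rho n.
Proof. exact: exprn_ge0. Qed.

Lemma cvg_cauchy_coef rho : 0 <= rho < 1 ->
  series (fun n => cauchy_coef rho n.+1) n @[n --> \oo] --> rho / (1 - rho).
Proof.
move=> /andP[r0 r1].
rewrite (_ : (fun n => cauchy_coef rho n.+1) = geometric rho rho).
  by apply: cvg_geometric_series; rewrite ger0_norm.
by apply/funext => n; rewrite /cauchy_coef exprS.
Qed.

Lemma total_cauchy_coef rho : 0 <= rho < 1 ->
  total_coef (cauchy_coef rho) = 2 * rho / (1 - rho).
Proof.
move=> r01; apply/cvg_lim => //; rewrite -mulrA.
by apply: cvg_series_scale; exact: cvg_cauchy_coef.
Qed.

Lemma cauchy_cos_series rho x : 0 <= rho < 1 ->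
  1 - total_coef (cauchy_coef rho) + cheb_series (cauchy_coef rho) (cos x) =
  poisson_kernel rho x.
Proof.
move=> r01; have /andP[r0 _] := r01.
have h := @cvg_cos_series R (cauchy_coef rho) (expr0 rho)
  (fun n => cauchy_coef_ge0 n r0) (cvgP _ (cvg_cauchy_coef r01)) x.
rewrite -(cvg_lim (@Rhausdorff R) h); apply/cvg_lim => //.
exact: cvg_poisson_kernel.
Qed.

Lemma cauchy_cos_series_ge0 rho x : 0 <= rho < 1 ->
  0 <= 1 - total_coef (cauchy_coef rho) + cheb_series (cauchy_coef rho) (cos x).
Proof.
move=> r01; rewrite cauchy_cos_series// /poisson_kernel.
rewrite divr_ge0 ?(ltW (poisson_den_gt0 x r01))// subr_ge0.
by case/andP: r01 => r0 r1; rewrite expr_le1// ltW.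
Qed.

Lemma cauchy_profile_cos rho x : 0 <= rho < 1 ->
  profile (cauchy_coef rho) (cos x) = poisson_kernel rho x.
Proof.
move=> r01; have r0 : 0 <= rho by case/andP: r01.
rewrite profileE ?cos_geN1 ?cos_le1// ?cauchy_cos_series//.
by move=> y _; exact: cauchy_cos_series_ge0.
Qed.

Lemma WC_density rho a A : 0 <= rho < 1 -> measurable A ->
  WC a rho A =
  (\int[unifS1]_(x in A) (profile (cauchy_coef rho) (dot (to_circle a) x))%:E)%E.
Proof.
move=> r01 mA; have /andP[r0 r1] := r01.
have c_ge0 n : 0 <= cauchy_coef rho n := cauchy_coef_ge0 n r0.
have mP : measurable_fun setT (profile (cauchy_coef rho)).
  by apply: measurable_profile => //; exact: cvgP (cvg_cauchy_coef r01).
rewrite /WC; case: eqVneq => [rho0|rhon0].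
  transitivity (\int[unifS1]_(x in A) (cst (1%E : \bar R)) x)%E.
    by rewrite integral_cst// mul1e.
  apply: ae_eq_integral_circle => //.
    by apply/measurable_EFinP; exact: (measurableT_comp mP (measurable_dot _)).
  move=> y; rewrite dot_to_circle cauchy_profile_cos// rho0.
  congr EFin; rewrite /poisson_kernel.
  have -> : (1 - 0) ^+ 2 + 2 * 0 * (1 - cos (y - a)) = 1 :> R by ring.
  by rewrite divr1 expr0n/= subr0.
have rho_gt0 : 0 < rho by rewrite lt_def rhon0.
pose s := - ln rho; have s0 : 0 < s by rewrite oppr_gt0 ln_lt0// rho_gt0.
have rhoE : rho = expR (- s) by rewrite opprK lnK.
have pi0 := @pi_gt0 R.
(* The Cauchy density with scale s and centre 0, arranged so that [wrapped_cauchy] applies to its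
   second factor. *)
pose f y : R := (2 * pi)^-1 * (2 * s / (s ^+ 2 + y ^+ 2)).
have D0 y : 0 < s ^+ 2 + y ^+ 2 by rewrite ltr_pwDl ?exprn_gt0 ?sqr_ge0.
have f0 y : 0 <= f y.
  apply: mulr_ge0; first by rewrite invr_ge0 mulr_ge0// ltW.
  by rewrite divr_ge0 ?(ltW (D0 y))// mulr_ge0// ltW.
have mf : measurable_fun setT f.
  apply: measurable_funM => //; apply: measurable_funM => //.
  apply: continuous_measurable_fun => y; apply: cvgV; first by rewrite gt_eqF.
  by apply: cvgD; [exact: cvg_cst|exact: exprn_continuous].
rewrite -(wrapped_density mf f0 mP (@profile_ge0 _ _) _ a mA); last first.
  move=> x xpi; rewrite cauchy_profile_cos// /f wrap_termZ.
  by apply: cvg_series_scale; rewrite rhoE; exact: wrapped_cauchy.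
rewrite /wrapped_law /pushforward /cauchy_std.
have mtoA (u v : R) : measurable ((fun x : measurableTypeR R => to_circle (u * x + v)) @^-1` A).
  rewrite -[X in measurable X]setTI.
  exact: (measurableT_comp (@measurable_to_circle R) (measurable_affine u v)).
have mfa : measurable_fun setT (fun x : measurableTypeR R => (f (x - a))%:E).
  by apply/measurable_EFinP; apply: (measurableT_comp mf); exact: measurable_funD.
have m1 : measurable_fun setT
    ((fun x : measurableTypeR R => (f (x - a))%:E) \_ (to_circle @^-1` A)).
  apply/(measurable_restrictT _ _).1; last exact: measurable_funTS.
  by rewrite -[X in measurable X]setTI; exact: measurable_to_circle.
have g0 x : (0 <= ((fun x : measurableTypeR R => (f (x - a))%:E)
    \_ (to_circle @^-1` A)) x)%E.
  by apply: erestrict_ge0 => y _; rewrite lee_fin.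
(* What remains is the substitution y = s x + a, which turns the standard Cauchy density into f
   centred at a. *)
rewrite integral_mkcond [RHS]integral_mkcond [RHS](ge0_integral_affine a s0)//.
rewrite -ge0_integralZl_EFin//=; last 2 first.
- exact: (measurableT_comp m1 (measurable_affine s a)).
- exact: ltW.
apply: eq_integral => x _; rewrite /patch.
rewrite (_ : (x \in _) = (s * x + a \in to_circle @^-1` A))//.
case: ifPn => _; last by rewrite mule0.
rewrite -EFinM; congr EFin; rewrite /f addrK.
have x1 : 0 < 1 + x ^+ 2 by rewrite ltr_pwDl// sqr_ge0.
have -> : s ^+ 2 + (s * x) ^+ 2 = s ^+ 2 * (1 + x ^+ 2) by ring.
move: (1 + x ^+ 2) x1 pi0 => D x1; move: (pi : R) => p p0.
by field; rewrite !gt_eqF.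
Qed.

Definition normal_coef rho (n : nat) : R := expR (- (n%:R ^+ 2 * rho / 2)).

Lemma normal_coef0 rho : normal_coef rho 0 = 1.
Proof. by rewrite /normal_coef expr0n !mul0r oppr0 expR0. Qed.

Lemma cvg_normal_coef rho : 0 < rho -> cvgn (series (fun n => normal_coef rho n.+1)).
Proof.
move=> rho0; have r2 : 0 < rho / 2 by rewrite divr_gt0.
apply: (series_le_cvg _ _ _ (expR_geometric r2)) => n; rewrite ?mulr_ge0 ?expR_ge0//.
apply: (@le_trans _ _ (expR (- (rho / 2 * n%:R)))); last by rewrite ler_peMl ?expR_ge0// ler1n.
rewrite ler_expR lerN2 mulrC -mulrA ler_wpM2r ?(ltW r2)//.
rewrite -natrX ler_nat (leq_trans (leqnSn n))// -mulnn leq_pmull//.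
Qed.

Lemma normal_law rho : 0 < rho ->
  (forall x, `|x| <= pi -> 0 <= 1 - total_coef (normal_coef rho) +
     cheb_series (normal_coef rho) (cos x)) /\
  forall a A, measurable A -> WN a rho A =
  (\int[unifS1]_(x in A) (profile (normal_coef rho) (dot (to_circle a) x))%:E)%E.
Proof.
move=> rho0; have [K K0 hK] := wrapped_gauss rho0.
have c_ge0 n : 0 <= normal_coef rho n by exact: expR_ge0.
have cc := cvg_normal_coef rho0.
have cosE x : limn (series (cos_term (normal_coef rho) x)) =
    1 - total_coef (normal_coef rho) + cheb_series (normal_coef rho) (cos x).
  by apply/cvg_lim => //; exact: (cvg_cos_series (normal_coef0 rho) c_ge0 cc).
(* K times the series is a limit of sums of positive exponentials, and K > 0. *)
have pos x : `|x| <= pi -> 0 <= 1 - total_coef (normal_coef rho) +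
     cheb_series (normal_coef rho) (cos x).
  move=> xpi; rewrite -cosE -(pmulr_rge0 _ K0).
  have := hK x xpi => h; rewrite -(cvg_lim (@Rhausdorff R) h).
  apply: limr_ge; first exact: cvgP h.
  near=> n; rewrite /series/= sumr_ge0// => -[|k] _ /=; rewrite ?addr_ge0 ?expR_ge0//.
split=> // .
pose sigma := Num.sqrt rho.
have sg0 : sigma != 0 by rewrite gt_eqF// sqrtr_gt0.
have sg2 : sigma ^+ 2 = rho by rewrite sqr_sqrtr// ltW.
pose k := normal_peak sigma * K.
have k0 : 0 < k by rewrite mulr_gt0// normal_peak_gt0.
pose f y := normal_peak sigma * expR (- (y ^+ 2 / (2 * rho))).
have fE a x : normal_pdf a sigma x = f (x - a).
  rewrite normal_pdfE// /normal_fun /f sg2; congr (_ * expR _).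
  by rewrite mulNr [2 * rho]mulr_natl.
have pi0 := @pi_gt0 R.
have mP : measurable_fun setT (profile (normal_coef rho)).
  exact: measurable_profile.
pose h t := 2 * pi * k * profile (normal_coef rho) t.
have tk0 : 0 <= 2 * pi * k by rewrite mulr_ge0 ?(ltW k0)// mulr_ge0// ltW.
have h0 t : 0 <= h t by rewrite mulr_ge0// profile_ge0.
have mh : measurable_fun setT h by exact: measurable_funM.
have mf : measurable_fun setT f.
  have := measurable_normal_pdf 0 sigma.
  by rewrite (_ : normal_pdf 0 sigma = f)//; apply/funext => x; rewrite fE subr0.
have f0 y : 0 <= f y by rewrite mulr_ge0 ?normal_peak_ge0 ?expR_ge0.
have wd a A : measurable A -> WN a rho A =
    (\int[unifS1]_(x in A) (h (dot (to_circle a) x))%:E)%E.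
  move=> mA; rewrite -(wrapped_density mf f0 mh h0 _ a mA).
    by rewrite /WN /wrapped_law /pushforward /normal_prob; apply: eq_integral => x _; rewrite fE.
  move=> x xpi; rewrite /h (profile_cos (normal_coef0 rho) c_ge0 cc pos) /f wrap_termZ.
  have -> : (2 * pi)^-1 * (2 * pi * k * limn (series (cos_term (normal_coef rho) x))) =
     normal_peak sigma * (K * limn (series (cos_term (normal_coef rho) x))).
    by rewrite -[2 * pi * k * _]mulrA mulKf ?/k -?mulrA// gt_eqF// mulr_gt0.
  by apply: cvg_series_scale; exact: hK.
(* Evaluate on the whole plane: the normal law and the profile both have integral 1. *)
have k1 : 2 * pi * k = 1.
  have := wd 0 setT measurableT.
  rewrite /WN /wrapped_law /pushforward preimage_setT /normal_prob integral_normal_pdf// => e.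
  have mc : measurable_fun setT (profile (normal_coef rho) \o cos : measurableTypeR R -> R).
    exact: (measurableT_comp mP (continuous_measurable_fun (@continuous_cos R))).
  have := integral_nu1_profile c_ge0 cc pos.
  rewrite integral_nu1//; last exact: profile_ge0.
  rewrite /angle_mean => eP.
  move: e; rewrite integral_unifS1; last 2 first.
  - by apply/measurable_EFinP; exact: (measurableT_comp mh (measurable_dot _)).
  - by move=> x; rewrite lee_fin.
  under eq_integral do rewrite dot_to_circle subr0 /h EFinM.
  rewrite ge0_integralZl_EFin//=; last 2 first.
  - by move=> x _; rewrite lee_fin profile_ge0.
  - by apply: measurable_funTS; exact/measurable_EFinP.
  by rewrite muleCA eP mule1 => -[].
by move=> a A mA; rewrite wd//; apply: eq_integral => x _; rewrite /h k1 mul1r.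
Unshelve. all: by end_near. Qed.

End wrapped_laws.

(** * The solution of beta = 1 *)

Section exp_bounds.
Context {R : realType}.
Implicit Types (x : R) (n : nat).

Lemma exp_coeffS x n : exp_coeff x n.+1 = exp_coeff x n * (x / n.+1%:R).
Proof.
rewrite /exp_coeff/= exprS factS natrM.
by field; rewrite pnatr_eq0 -lt0n fact_gt0 gt_eqF// ltr_wpDr.
Qed.

Lemma expR_ge_partial x n : 0 <= x -> series (exp_coeff x) n <= expR x.
Proof.
move=> x0; apply: nondecreasing_cvgn_le; last exact: is_cvg_series_exp_coeff.
by apply: nondecreasing_series => i _ _; exact: exp_coeff_ge0.
Qed.

(** Equivalently n! k! <= (n + k)!; it bounds the remainder of the exponential series by
    [exp_coeff x n * expR x]. *)
Lemma exp_coeffD_le x n k : 0 <= x ->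
  exp_coeff x (n + k)%N <= exp_coeff x n * exp_coeff x k.
Proof.
move=> x0; elim: k => [|k IH].
  by rewrite addn0 /exp_coeff/= expr0 fact0 divr1 mulr1.
rewrite addnS !exp_coeffS [leRHS]mulrA; apply: ler_pM => //.
- exact: exp_coeff_ge0.
- by rewrite divr_ge0.
by rewrite ler_wpM2l// lef_pV2 ?posrE ?ltr0n// ler_nat ltnS leq_addl.
Qed.

(** Read as an upper bound for [expR x] when the factor is positive; with [expR_ge_partial] it
    encloses the exponential between rational functions of x. *)
Lemma expR_le_partial x n : 0 <= x ->
  expR x * (1 - exp_coeff x n) <= series (exp_coeff x) n.
Proof.
move=> x0; rewrite mulrBr mulr1 lerBlDr mulrC.
have c := @is_cvg_series_exp_coeff R x.
have key k : series (exp_coeff x) (n + k)%N <=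
    series (exp_coeff x) n + exp_coeff x n * series (exp_coeff x) k.
  have s0 : series (exp_coeff x) 0%N = 0 by rewrite /series/= big_geq.
  elim: k => [|k IH]; first by rewrite addn0 s0 mulr0 addr0.
  by rewrite addnS !seriesSr mulrDr addrA lerD// exp_coeffD_le.
rewrite -[leLHS]/(limn (series (exp_coeff x))); apply: limr_le => //; near=> m.
have nm : (n <= m)%N by near: m; exists n.
rewrite -(subnKC nm) (le_trans (key _))// lerD2l ler_wpM2l ?exp_coeff_ge0//.
exact: expR_ge_partial.
Unshelve. all: by end_near. Qed.

End exp_bounds.

(** * Monotonicity and continuity of beta for the normal laws *)

Section root.
Context {R : realType}.
Implicit Types (rho : R) (n : nat).

Local Notation F rho := (total_coef (@normal_coef R rho)).

Lemma cvg_seriesB (u v : nat -> R) (l m : R) :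
  series u n @[n --> \oo] --> l -> series v n @[n --> \oo] --> m ->
  series (fun n => u n - v n) n @[n --> \oo] --> l - m.
Proof.
move=> ul vm; have h : series u n - series v n @[n --> \oo] --> l - m.
  by apply: cvgB; [exact: ul|exact: vm].
by rewrite (_ : series _ = fun n => series u n - series v n)//;
  apply/funext => n; rewrite /series/= sumrB.
Qed.

Lemma normal_coefS_exp rho n :
  normal_coef rho n = expR (- (rho / 2)) ^+ (n ^ 2).
Proof.
by rewrite /normal_coef -expRM_natl; congr expR; rewrite natrX; field.
Qed.

Lemma cvg_total_normal_coef rho : 0 < rho ->
  series (fun n => 2 * normal_coef rho n.+1) n @[n --> \oo] --> F rho.
Proof. by move=> rho0; apply: cvg_total_coef; exact: cvg_normal_coef. Qed.

(** The difference series has nonnegative terms, and its first term is already positive. *)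
Lemma total_normal_coef_decr rho1 rho2 : 0 < rho1 -> rho1 < rho2 ->
  F rho2 < F rho1.
Proof.
move=> r1 r12; have r2 : 0 < rho2 by exact: lt_trans r12.
have h1 := cvg_total_normal_coef r1; have h2 := cvg_total_normal_coef r2.
have mono n : normal_coef rho2 n <= normal_coef rho1 n.
  rewrite ler_expR lerN2 ler_pM2r//.
  by apply: ler_wpM2l; [exact: sqr_ge0|exact: ltW].
pose u n := 2 * normal_coef rho1 n.+1 - 2 * normal_coef rho2 n.+1.
have hu : series u n @[n --> \oo] --> F rho1 - F rho2 := cvg_seriesB h1 h2.
have : u 0%N <= F rho1 - F rho2.
  rewrite -(cvg_lim (@Rhausdorff R) hu); apply: series_ge_first; last exact: cvgP hu.
  by move=> n; rewrite subr_ge0 ler_wpM2l.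
have : 0 < u 0%N.
  by rewrite subr_gt0 ltr_pM2l// ltr_expR ltrN2 expr1n !mul1r ltr_pM2r.
lra.
Qed.

(** Supplies continuity for the intermediate value theorem. With k = (n + 1)^2 / 2 and d the
    increment, each difference of exponentials is at most [expR (- k) * (k * d)] since rho1 >= 1;
    one factor [expR (- (k / 2))] absorbs k and the other gives summability. *)
Lemma total_normal_coef_lipschitz : exists L : R, 0 <= L /\
  forall rho1 rho2, 1 <= rho1 -> rho1 <= rho2 ->
  0 <= F rho1 - F rho2 <= L * (rho2 - rho1).
Proof.
(* One factor 2 belongs to the coefficients, the other comes from [k * expR (- (k / 2)) <= 2]; the
   exponent uses k / 2 >= n / 4. *)
pose v n : R := 2 * (2 * expR (- (4^-1 * n%:R))).
have cv : cvgn (series v).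
  have q0 : 0 < 4^-1 :> R by [].
  exact: (is_cvg_seriesZ (k := 2 : R) (expR_geometric q0)).
exists (limn (series v)); split.
  apply: limr_ge => //; near=> n; rewrite /series/= sumr_ge0// => i _.
  by rewrite !mulr_ge0 ?expR_ge0.
move=> rho1 rho2 r1 r12.
have r1' : 0 < rho1 by lra. have r2' : 0 < rho2 by lra.
have h1 := cvg_total_normal_coef r1'; have h2 := cvg_total_normal_coef r2'.
pose u n := 2 * normal_coef rho1 n.+1 - 2 * normal_coef rho2 n.+1.
have hu : series u n @[n --> \oo] --> F rho1 - F rho2 := cvg_seriesB h1 h2.
have uv n : 0 <= u n <= v n * (rho2 - rho1).
  rewrite /u /normal_coef; set k := n.+1%:R ^+ 2 / 2 : R.
  have -> : n.+1%:R ^+ 2 * rho1 / 2 = k * rho1 by rewrite /k; field.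
  have -> : n.+1%:R ^+ 2 * rho2 / 2 = k * rho2 by rewrite /k; field.
  have k0 : 0 <= k by rewrite divr_ge0 ?sqr_ge0.
  have kn : n%:R / 2 <= k.
    rewrite /k ler_pM2r// -natrX ler_nat (leq_trans (leqnSn n))// -mulnn leq_pmull//.
  clearbody k; have -> : k * rho2 = k * rho1 + k * (rho2 - rho1) by ring.
  rewrite opprD expRD -mulrBr -[X in X - _]mulr1 -mulrBr.
  set d := rho2 - rho1; have d0 : 0 <= d by rewrite subr_ge0.
  have e1 : expR (- (k * d)) <= 1 by rewrite -expR0 ler_expR oppr_le0 mulr_ge0.
  have e2 : 1 - expR (- (k * d)) <= k * d.
    by have := expR_ge1Dx (- (k * d)); lra.
  have e3 : expR (- (k * rho1)) <= expR (- (k / 2)) * expR (- (k / 2)).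
    by rewrite -expRD ler_expR -opprD lerN2 -mulrDr ler_wpM2l//; lra.
  have e4 : k * expR (- (k / 2)) <= 2.
    rewrite expRN ler_pdivrMr ?expR_gt0//.
    by have := expR_ge1Dx (k / 2); lra.
  have e5 : expR (- (k / 2)) <= expR (- (4^-1 * n%:R)).
    by rewrite ler_expR lerN2; lra.
  rewrite !mulr_ge0 ?expR_ge0 ?subr_ge0//= /v -!mulrA ler_pM2l//.
  apply: (@le_trans _ _ ((expR (- (k / 2)) * expR (- (k / 2))) * (k * d))).
    by apply: ler_pM => //; rewrite subr_ge0.
  apply: (@le_trans _ _ (2 * (expR (- (k / 2)) * d))).
    rewrite (_ : _ * (k * d) = k * expR (- (k / 2)) * (expR (- (k / 2)) * d)); last by ring.
    by rewrite ler_wpM2r// mulr_ge0 ?expR_ge0.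
  by rewrite ler_pM2l// ler_wpM2r.
apply/andP; split.
  rewrite -(cvg_lim (@Rhausdorff R) hu); apply: limr_ge; first exact: cvgP hu.
  near=> n; rewrite /series/= sumr_ge0// => i _.
  by have /andP[] := uv i.
have hv : series (fun n => (rho2 - rho1) * v n) n @[n --> \oo] -->
    (rho2 - rho1) * limn (series v) by exact: cvg_series_scale.
rewrite [leRHS]mulrC -(cvg_lim (@Rhausdorff R) hu) -(cvg_lim (@Rhausdorff R) hv).
apply: lim_series_le; [exact: cvgP hu|exact: cvgP hv|move=> n].
by rewrite mulrC; have /andP[] := uv n.
Unshelve. all: by end_near. Qed.

Lemma total_normal_coef_continuous rho : 1 < rho ->
  {for rho, continuous (fun r : R => F r)}.
Proof.
move=> r1; have [L [L0 hL]] := total_normal_coef_lipschitz.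
apply/cvgrPdist_le => /= e e0.
have e1 : 0 < e / (L + 1) by rewrite divr_gt0// ltr_wpDl.
near=> y.
have y1 : 1 < y by near: y; exact: lt_nbhsr.
have ye : `|rho - y| <= e / (L + 1).
  by near: y; apply: cvgr_dist_le.
have key : L * `|rho - y| <= e.
  rewrite ler_pdivlMr ?ltr_wpDl// in ye; rewrite (le_trans _ ye)// mulrC ler_wpM2l//.
  by rewrite lerDl.
rewrite (le_trans _ key)//; have [h|h] := leP rho y.
  have /andP[a b] := hL _ _ (ltW r1) h.
  by rewrite ger0_norm// distrC ger0_norm ?subr_ge0.
have /andP[a b] := hL _ _ (ltW y1) (ltW h).
by rewrite distrC ger0_norm// ger0_norm// subr_ge0 ltW.
Unshelve. all: by end_near. Qed.

End root.

(** * Rational enclosures and the root *)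

Section numerics.
Context {R : realType}.

Local Notation F rho := (total_coef (@normal_coef R rho)).

(** Ten terms are enough for the eight decimals below: at x near 0.7854 the coefficient of index 10
    is about 2.5 / 10^8. *)
Lemma series_exp_coeff10 (x : R) :
  (series (exp_coeff x) 10 = 1 + x * (1 + x / 2 * (1 + x / 3 * (1 + x / 4 *
    (1 + x / 5 * (1 + x / 6 * (1 + x / 7 * (1 + x / 8 * (1 + x / 9))))))))) /\
  (exp_coeff x 10 = x ^+ 10 / 2 / 3 / 4 / 5 / 6 / 7 / 8 / 9 / 10).
Proof.
have e0 : exp_coeff x 0 = 1 by rewrite /exp_coeff/= expr0 fact0 divr1.
have s0 : series (exp_coeff x) 0%N = 0 by rewrite /series/= big_geq.
split; first by rewrite !seriesSr s0 !exp_coeffS e0; field.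
by rewrite !exp_coeffS e0; field.
Qed.

Lemma expRN_ge (y l : R) n : 0 <= y -> 0 <= l -> 0 < 1 - exp_coeff y n ->
  l * series (exp_coeff y) n <= 1 - exp_coeff y n -> l <= expR (- y).
Proof.
move=> y0 l0 n2 n1; have h := expR_le_partial n y0.
have E0 := expR_gt0 y.
rewrite expRN -[leRHS]div1r ler_pdivlMr// -(ler_pM2r n2) mul1r -mulrA.
by rewrite (le_trans _ n1)// ler_wpM2l.
Qed.

Lemma expRN_le (y l : R) n : 0 <= y -> 0 <= l ->
  1 <= l * series (exp_coeff y) n -> expR (- y) <= l.
Proof.
move=> y0 l0 n1; have h := expR_ge_partial n y0.
rewrite expRN -[leLHS]div1r ler_pdivrMr ?expR_gt0//.
by rewrite (le_trans n1)// ler_wpM2l.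
Qed.

(** The point is half of 1.5708175, the left end of the interval around 1.570818, and 0.45593329
    lies just below the exponential. [expRN_upper] is the mirror image at 1.5708185, with 0.45593308
    just above. *)
Lemma expRN_lower : 4559 / 10 ^+ 4 + 3329 / 10 ^+ 8 <=
  expR (- ((157 / 10 ^+ 2 + 818 / 10 ^+ 6 - (2 * 10 ^+ 6)^-1) / 2)) :> R.
Proof.
have [s e] := series_exp_coeff10 ((157 / 10 ^+ 2 + 818 / 10 ^+ 6 - (2 * 10 ^+ 6)^-1) / 2).
by apply: (@expRN_ge _ _ 10); rewrite ?s ?e; lra.
Qed.

Lemma expRN_upper :
  expR (- ((157 / 10 ^+ 2 + 818 / 10 ^+ 6 + (2 * 10 ^+ 6)^-1) / 2)) <=
  4559 / 10 ^+ 4 + 3308 / 10 ^+ 8 :> R.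
Proof.
have [s e] := series_exp_coeff10 ((157 / 10 ^+ 2 + 818 / 10 ^+ 6 + (2 * 10 ^+ 6)^-1) / 2).
by apply: (@expRN_le _ _ 10); rewrite ?s; lra.
Qed.

Lemma total_normal_coef_lower :
  1 < F (157 / 10 ^+ 2 + 818 / 10 ^+ 6 - (2 * 10 ^+ 6)^-1).
Proof.
have := expRN_lower; set a : R := (_ + _ - _); set l := (_ + _ : R) => hl.
have l0 : 0 <= l by rewrite /l; lra.
have a0 : 0 < a by rewrite /a; lra.
have h := cvg_total_normal_coef a0.
have lX n : l ^+ n <= expR (- (a / 2)) ^+ n by rewrite lerXn2r ?nnegrE ?expR_ge0.
apply: (@lt_le_trans _ _ (2 * l ^+ 1 + 2 * l ^+ 4 + 2 * l ^+ 9 + 2 * l ^+ 16)).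
  by rewrite /l; lra.
apply: (@le_trans _ _ (series (fun n => 2 * normal_coef a n.+1) 4)); last first.
  rewrite -(cvg_lim (@Rhausdorff R) h); apply: nondecreasing_cvgn_le.
    by apply: nondecreasing_series => n _ _; rewrite mulr_ge0 ?expR_ge0.
  exact: cvgP h.
have s0 : series (fun n => 2 * normal_coef a n.+1) 0%N = 0 by rewrite /series/= big_geq.
rewrite !seriesSr s0 add0r !normal_coefS_exp.
by rewrite !lerD// ler_pM2l// lX.
Qed.

Lemma total_normal_coef_upper :
  F (157 / 10 ^+ 2 + 818 / 10 ^+ 6 + (2 * 10 ^+ 6)^-1) < 1.
Proof.
have := expRN_upper; set b : R := (_ + _^-1); set u := (_ + _ : R) => hu.
have b0 : 0 < b by rewrite /b; lra.
have h := cvg_total_normal_coef b0.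
set q := expR (- (b / 2)) in hu *; have q0 : 0 <= q by exact: expR_ge0.
have u2 : u <= 2^-1 by rewrite /u; lra.
have qX n : q ^+ n <= u ^+ n by rewrite lerXn2r// nnegrE (le_trans q0).
set f := fun n => 2 * normal_coef b n.+1 in h *.
have f4 : series f 4 <= 2 * u ^+ 1 + 2 * u ^+ 4 + 2 * u ^+ 9 + 2 * u ^+ 16.
  have s0 : series f 0%N = 0 by rewrite /series/= big_geq.
  rewrite !seriesSr s0 add0r /f !normal_coefS_exp -/q.
  by rewrite !lerD// ler_pM2l// qX.
(* A telescoping majorant of the tail: since (m + 5)^2 = 25 + m^2 + 10 m and q <= u <= 1/2, the term
   of index 4 + m is at most [2 u^25 2^-m], which is the drop of [4 u^25 2^-m] from m to m + 1. *)
have tail m : series f (4 + m)%N + 4 * u ^+ 25 * 2^-1 ^+ m <= series f 4 + 4 * u ^+ 25.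
  elim: m => [|m IH]; first by rewrite addn0 expr0 mulr1.
  rewrite addnS seriesSr (le_trans _ IH)// -addrA lerD2l.
  rewrite /f normal_coefS_exp -/q.
  have : q ^+ ((4 + m).+1 ^ 2) <= u ^+ 25 * 2^-1 ^+ m.
    rewrite (_ : ((4 + m).+1 ^ 2 = 25 + (m ^ 2 + 10 * m))%N); last first.
      by rewrite -addSn sqrnD; ring.
    rewrite exprD; apply: ler_pM; rewrite ?exprn_ge0//.
    have q2 : q <= 2^-1 by exact: le_trans u2.
    rewrite (@le_trans _ _ (q ^+ m))//; last by rewrite lerXn2r ?nnegrE.
    have q1 : q <= 1 by rewrite (le_trans q2)// invf_le1// ler1n.
    rewrite ler_wiXn2l//.
    by rewrite (leq_trans _ (leq_addl _ _))// leq_pmull.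
  rewrite [2^-1 ^+ m.+1]exprS.
  by move: (u ^+ 25) (2^-1 ^+ m) (q ^+ _) => A B C; lra.
have le4 : F b <= series f 4 + 4 * u ^+ 25.
  rewrite -(cvg_lim (@Rhausdorff R) h); apply: limr_le; first exact: cvgP h.
  near=> m; have m4 : (4 <= m)%N by near: m; exists 4%N.
  rewrite -(subnKC m4) (le_trans _ (tail (m - 4)%N))// lerDl.
  by rewrite !mulr_ge0 ?exprn_ge0// (le_trans q0).
apply: (le_lt_trans (le_trans le4 (lerD f4 (lexx _)))).
by rewrite /u; lra.
Unshelve. all: by end_near. Qed.

(** The intermediate value theorem between the two ends gives existence and accuracy at once; the
    strict comparisons with 1 exclude the ends themselves. *)
Lemma normal_root : exists rho0 : R, [/\ 1 < rho0, F rho0 = 1 &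
  `|rho0 - (157 / 10 ^+ 2 + 818 / 10 ^+ 6)| < (2 * 10 ^+ 6)^-1].
Proof.
have := total_normal_coef_lower; have := total_normal_coef_upper.
set m := (_ / _ + _ / _ : R); set d := (_^-1 : R) => hb ha.
have m1 : 1 < m - d by rewrite /m /d; lra.
have d0 : 0 < d by rewrite /d; lra.
clearbody m d.
have [|||c + Fc] := @IVT R (fun r => F r) (m - d) (m + d) 1.
- lra.
- apply: continuous_in_subspaceT => x; rewrite inE/= in_itv/= => /andP[x1 x2].
  by apply: total_normal_coef_continuous; rewrite (lt_le_trans m1).
- by rewrite ge_min le_max (ltW hb) (ltW ha) orbT.
rewrite in_itv/= => /andP[c1 c2]; exists c; split=> //.
  exact: lt_le_trans c1.
rewrite ltr_norml; apply/andP; split.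
- have : c != m - d by apply: contraTneq ha => <-; rewrite Fc ltxx.
  move=> cn; have cl : m - d < c by rewrite lt_def cn.
  by lra.
- have : c != m + d by apply: contraTneq hb => <-; rewrite Fc ltxx.
  move=> cn; have cu : c < m + d by rewrite lt_def eq_sym cn.
  by lra.
Qed.

End numerics.

(** * Beta and the mixture representation for the two families *)

Section prelim.
Context {R : realType}.

Lemma WC_law (rho : R) (g : R -> R) : 0 <= rho < 1 ->
  has_profile (fun alpha => WC alpha rho) g ->
  beta g = (2 * rho / (1 - rho))%:E /\
  forall alpha A, measurable A ->
    WC alpha rho A = mixture (beta g) (fun n => geoN n (1 - rho)) (to_circle alpha) A.
Proof.
move=> r01 Pg; have /andP[r0 r1] := r01.
have c_ge0 n : 0 <= cauchy_coef rho n by exact: cauchy_coef_ge0.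
have cc := cvgP _ (cvg_cauchy_coef r01).
have pos (x : R) : `|x| <= pi -> 0 <= 1 - total_coef (cauchy_coef rho) +
    cheb_series (cauchy_coef rho) (cos x).
  by move=> _; exact: cauchy_cos_series_ge0.
have PE a A := @WC_density R rho a A r01.
have bE := beta_has_profile c_ge0 cc pos PE Pg.
rewrite bE total_cauchy_coef//; split=> // alpha A mA.
rewrite -(total_cauchy_coef r01).
apply: (mixture_profile c_ge0 cc pos PE) => //.
- by move=> n; rewrite /geoN subKr mulr_ge0 ?subr_ge0 ?(ltW r1)// exprn_ge0.
- case=> // n _; rewrite total_cauchy_coef// /geoN subKr/= /cauchy_coef exprS.
  by field; rewrite subr_eq0 gt_eqF.
Qed.

Lemma WC_has_profile (rho : R) : 0 <= rho < 1 ->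
  has_profile (fun alpha => WC alpha rho) (profile (cauchy_coef rho)).
Proof.
move=> r01; have /andP[r0 r1] := r01.
apply: (has_profile_profile (fun n => cauchy_coef_ge0 n r0) (cvgP _ (cvg_cauchy_coef r01))).
by move=> a A; exact: WC_density.
Qed.

Lemma WN_has_profile (rho : R) : 0 < rho ->
  has_profile (fun alpha => WN alpha rho) (profile (normal_coef rho)).
Proof.
move=> rho0; have [_ PE] := normal_law rho0.
exact: (has_profile_profile (fun n => expR_ge0 _) (cvg_normal_coef rho0) PE).
Qed.

Lemma WN_law (rho : R) (g : R -> R) : 0 < rho ->
  has_profile (fun alpha => WN alpha rho) g ->
  beta g = (total_coef (normal_coef rho))%:E /\
  forall alpha A, measurable A ->
    WN alpha rho A =
    mixture (beta g) (fun n => br n rho (fine (beta g))) (to_circle alpha) A.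
Proof.
move=> rho0 Pg; have [pos PE] := normal_law rho0.
have c_ge0 n : 0 <= normal_coef rho n by exact: expR_ge0.
have cc := cvg_normal_coef rho0.
have bE := beta_has_profile c_ge0 cc pos PE Pg.
rewrite bE; split=> // alpha A mA.
have b0 : 0 < total_coef (normal_coef rho).
  rewrite (lt_le_trans _ (series_ge_first _ (cvgP _ (cvg_total_coef cc))))//.
    by rewrite mulr_gt0 ?expR_gt0.
  by move=> n; rewrite mulr_ge0.
apply: (mixture_profile c_ge0 cc pos PE) => //.
- by move=> n; rewrite /br !mulr_ge0 ?expR_ge0// invr_ge0 ltW.
- by move=> n _; rewrite /br /= /normal_coef; field; rewrite gt_eqF.
Qed.

Lemma total_normal_coefE (rho : R) : 0 < rho ->
  ((total_coef (normal_coef rho))%:E =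
   2%:E * \sum_(1 <= n <oo) (expR (- (n%:R ^+ 2 * rho / 2)))%:E)%E.
Proof.
move=> rho0; rewrite -nneseries_total_coef//; last exact: cvg_normal_coef.
rewrite -(nneseries_addn 1); last by move=> n; rewrite lee_fin expR_ge0.
rewrite -nneseriesZl; last by move=> n _; rewrite lee_fin expR_ge0.
by apply: eq_eseriesr => n _; rewrite addn1 -EFinM.
Qed.

End prelim.

Theorem theorem8 (R : realType) :
  (forall rho : R, 0 <= rho < 1 ->
     (exists g : R -> R, has_profile (fun alpha => WC alpha rho) g) /\
     forall g : R -> R, has_profile (fun alpha => WC alpha rho) g ->
       beta g = (2 * rho / (1 - rho))%:E /\
       (rho <= 1 / 3 ->
        forall (eta : R * R) (alpha : R) (A : set (R * R)),
          S1 eta -> eta = to_circle alpha -> measurable A ->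
          WC alpha rho A =
            mixture (beta g) (fun n => geoN n (1 - rho)) eta A))
  /\
  ((forall rho : R, 0 < rho ->
      exists g : R -> R, has_profile (fun alpha => WN alpha rho) g) /\
   forall g : R -> R -> R,
     (forall rho : R, 0 < rho ->
        has_profile (fun alpha => WN alpha rho) (g rho)) ->
     (forall rho : R, 0 < rho ->
        beta (g rho) \is a fin_num /\
        beta (g rho) =
          (2%:E * \sum_(1 <= n <oo) (expR (- (n%:R ^+ 2 * rho / 2)))%:E)%E) /\
     exists rho0 : R,
       [/\ 0 < rho0 /\ beta (g rho0) = 1%E,
           forall rho : R, 0 < rho -> beta (g rho) = 1%E -> rho = rho0,
           `|rho0 - (157 / 10 ^+ 2 + 818 / 10 ^+ 6)| < (2 * 10 ^+ 6)^-1 &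
           forall rho : R, rho0 <= rho ->
           forall (eta : R * R) (alpha : R) (A : set (R * R)),
             S1 eta -> eta = to_circle alpha -> measurable A ->
             WN alpha rho A =
               mixture (beta (g rho))
                 (fun n => br n rho (fine (beta (g rho)))) eta A]).
Proof.
split=> [rho r01|].
  split; first by eexists; exact: WC_has_profile.
  move=> g Pg; have [bE mixE] := WC_law r01 Pg; split=> // _ eta alpha A _ -> mA.
  exact: mixE.
split=> [rho rho0|g Pg]; first by eexists; exact: WN_has_profile.
have bE rho (rho0 : 0 < rho) : beta (g rho) = (total_coef (normal_coef rho))%:E.
  by have [] := WN_law rho0 (Pg _ rho0).
split=> [rho rho0|]; first by rewrite bE// -total_normal_coefE.
have [rho0 [rho1 F1 rhoB]] := @normal_root R.
have rho_gt0 : 0 < rho0 by exact: lt_trans rho1.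
exists rho0; split=> //; first by rewrite bE// F1.
- move=> rho rhop; rewrite bE// => -[F1'].
  have [h|h|->//] := ltgtP rho rho0.
  + by have := total_normal_coef_decr rhop h; rewrite F1 F1' ltxx.
  + by have := total_normal_coef_decr rho_gt0 h; rewrite F1 F1' ltxx.
- move=> rho rho0le eta alpha A _ -> mA.
  have rhop : 0 < rho by exact: lt_le_trans rho0le.
  by have [_] := WN_law rhop (Pg _ rhop); apply.
Qed.
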